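(* Let $p>2$ and let $(Y_n,T_n)_{n\in\mathbb{N}}$ be a martingale difference sequence in $L^p(T_1)$. Let $k,\gamma$ be real numbers with $p\ge \gamma+\left(\frac p2-1\right)k$, and let $(a_i)_{i\in\mathbb{N}}$ be a positive, non-decreasing sequence of real numbers such that $\displaystyle\sum_{i=1}^\infty\frac{1}{a_i^k}$ converges in $\mathbb{R}$ and $$\sum_{i=1}^\infty T_1\left(\frac{|Y_i|^p}{a_i^\gamma}\right)$$ is order convergent. Then $\displaystyle\frac{1}{a_n}\sum_{i=1}^n Y_i\to 0$ in order as $n\to\infty$.
   Context: A conditional expectation (operator) on a Dedekind complete Riesz space $F$ with weak order unit is a positive order continuous linear projection on $F$ that maps weak order units to weak order units and whose range is a Dedekind complete Riesz subspace of $F$. It is strictly positive if $T|f|=0$ implies $f=0$. $R(T)$ denotes the range of $T$. Let $E$ be a Dedekind complete Riesz space with weak order unit $e$ and let $E^u$ be its universal completion, an $f$-algebra with algebraic unit $e$; for $f\in E^u_+$ the power $f^p$ is defined by functional calculus. Let $T_1$ be a strictly positive conditional expectation on $E$. The natural domain of $T_1$ is $L^1(T_1)=\mathrm{dom}(T_1)-\mathrm{dom}(T_1)\subset E^u$, where $f\in\mathrm{dom}(T_1)$ if $f\in E^u_+$ and there is an upwards directed net $f_\alpha\uparrow f$ in $E_+$ with $(T_1f_\alpha)$ order bounded in $E^u$; in this case $T_1f$ is the order limit in $E^u$ of $T_1f_\alpha$. $T_1$ is extended in this way to a conditional expectation on $L^1(T_1)$, which is a Dedekind complete Riesz space with weak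 order unit $e$. For $1\le p<\infty$, $L^p(T_1)=\{x\in L^1(T_1): |x|^p\in L^1(T_1)\}$. A filtration on $L^1(T_1)$ is a family $(T_i)_{i\in\mathbb{N}}$ of conditional expectations on $L^1(T_1)$ (with first member $T_1$) with $T_iT_j=T_jT_i=T_i$ for all $i<j$. $(Y_i,T_i)_{i\in\mathbb{N}}$ is a martingale difference sequence in $L^p(T_1)$ if $(T_i)$ is a filtration on $L^1(T_1)$, $Y_i\in L^p(T_1)\cap R(T_i)$ for all $i$, and $T_{i-1}Y_i=0$ for $i\ge 2$. Conventions: the conditional expectations fix the chosen unit ($T_ie=e$ for all $i$). Order convergence is understood in $E^u$; a series converges in order if its sequence of partial sums does. *)

(* Defs.v *)
From HB Require Import structures.
From mathcomp Require Import all_boot all_order all_algebra.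
From mathcomp Require Import all_classical all_reals all_analysis.

Set Implicit Arguments.
Unset Strict Implicit.
Unset Printing Implicit Defensive.

Import Order.TTheory GRing.Theory Num.Theory numFieldNormedType.Exports.

Local Open Scope classical_set_scope.
Local Open Scope ring_scope.

(* The lattice operations are part of the mixin: the hierarchy has no room for a
   join of Order.Lattice and GRing.Zmodule below Num.RealDomain. *)
HB.mixin Record POrderedLmodule_isRiesz (R : numDomainType) V
    of GRing.Lmodule R V & Num.POrderedZmodule V := {
  rjoin : V -> V -> V ;
  rmeet : V -> V -> V ;
  riesz_leUx : forall x y z : V, (rjoin x y <= z) = (x <= z) && (y <= z) ;
  riesz_lexI : forall x y z : V, (z <= rmeet x y) = (z <= x) && (z <= y) ;
  riesz_lerD2r : forall z x y : V, x <= y -> x + z <= y + z ;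
  riesz_scaler_ge0 : forall (c : R) (x : V), 0 <= c -> 0 <= x -> 0 <= c *: x
}.

#[short(type="rieszType")]
HB.structure Definition Riesz (R : numDomainType) :=
  { V of GRing.Lmodule R V & Num.POrderedZmodule V
       & POrderedLmodule_isRiesz R V }.

Section RieszSpaces.
Context {R : realType} {V : rieszType R}.
Implicit Types (F A D : set V) (x y u : V) (T : V -> V).

Definition rabs x : V := rjoin x (- x).

Definition riesz_subspace F : Prop :=
  [/\ F 0,
      forall (c : R) x y, F x -> F y -> F (c *: x + y),
      forall x y, F x -> F y -> F (rjoin x y)
    & forall x y, F x -> F y -> F (rmeet x y)].

(* Supremum and infimum inside the ordered set F; they may differ from those
   computed in V. *)
Definition sup_in F A x : Prop :=
  [/\ F x, ubound A x & forall b, F b -> ubound A b -> x <= b].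
Definition inf_in F A x : Prop :=
  [/\ F x, lbound A x & forall b, F b -> lbound A b -> b <= x].

Definition dedekind_complete F : Prop :=
  forall A, A `<=` F -> A !=set0 -> (exists2 b, F b & ubound A b) ->
    exists x, sup_in F A x.

Definition weak_order_unit F u : Prop :=
  [/\ F u, 0 <= u & forall x, F x -> 0 <= x -> rmeet u x = 0 -> x = 0].

Definition up_directed A : Prop :=
  A !=set0 /\ forall x y, A x -> A y -> exists z, [/\ A z, x <= z & y <= z].
Definition down_directed A : Prop :=
  A !=set0 /\ forall x y, A x -> A y -> exists z, [/\ A z, z <= x & z <= y].

Definition positive_on F T : Prop := forall x, F x -> 0 <= x -> 0 <= T x.

(* For positive T: D decreasing to 0 in F implies T(D) decreasing to 0 in F. *)
Definition order_continuous_on F T : Prop :=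
  forall D, D `<=` F -> down_directed D -> inf_in F D 0 ->
    inf_in F (T @` D) 0.

(* An operator on the Riesz subspace F is a function on V of which only the
   values on F matter. *)
Record cond_expectation F T : Prop := CondExpectation {
  ce_maps : forall x, F x -> F (T x) ;
  ce_linear : forall (c : R) x y, F x -> F y ->
    T (c *: x + y) = c *: T x + T y ;
  ce_positive : positive_on F T ;
  ce_order_continuous : order_continuous_on F T ;
  ce_projection : forall x, F x -> T (T x) = T x ;
  ce_weak_unit : forall u, weak_order_unit F u -> weak_order_unit F (T u) ;
  ce_range_subspace : riesz_subspace (T @` F) ;
  ce_range_complete : dedekind_complete (T @` F)
}.

Definition strictly_positive_on F T : Prop :=
  forall x, F x -> T (rabs x) = 0 -> x = 0.

Definition filtration F (T : nat -> V -> V) : Prop :=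
  (forall i, cond_expectation F (T i)) /\
  (forall i j, (i < j)%N -> forall x, F x ->
     T i (T j x) = T i x /\ T j (T i x) = T i x).

Definition laterally_complete : Prop :=
  forall A, A !=set0 -> (forall x, A x -> 0 <= x) ->
    (forall x y, A x -> A y -> x <> y -> rmeet x y = 0) ->
    exists x, isLub A x.

Definition universally_complete : Prop :=
  dedekind_complete setT /\ laterally_complete.

Definition f_algebra_with_unit (mul : V -> V -> V) (e : V) : Prop :=
  [/\ [/\ forall (c : R) x y z, mul (c *: x + y) z = c *: mul x z + mul y z,
          forall (c : R) x y z, mul z (c *: x + y) = c *: mul z x + mul z y
        & forall x y z, mul x (mul y z) = mul (mul x y) z],
      forall x y, 0 <= x -> 0 <= y -> 0 <= mul x y,
      forall x y z, rmeet x y = 0 -> 0 <= z ->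
        rmeet (mul z x) y = 0 /\ rmeet (mul x z) y = 0
    & forall x, mul e x = x /\ mul x e = x].

(* Order convergence in V itself. *)
Definition order_cvg (s : nat -> V) (l : V) : Prop :=
  exists h : nat -> V,
    [/\ forall n, h n.+1 <= h n,
        infimums (range h) 0
      & forall n, rabs (s n - l) <= h n].

Definition order_cvg_series (s : nat -> V) : Prop :=
  exists l, order_cvg (series s) l.

(* The component of e in the band generated by (x - t e)^+, that is
   (I - E_t) e for the right-continuous spectral system (E_t) of x w.r.t. e. *)
Definition spectral (e x : V) (t : R) : V :=
  supremum 0 [set rmeet e (n%:R *: rjoin (x - t *: e) 0)
             | n in [set: nat]].

(* ((c, a), b) stands for the step c on the interval ]a, b]. *)
Definition step_wf (s : seq (R * R * R)) : bool :=
  all (fun q => q.1.2 <= q.2) s.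
Definition step_fun (s : seq (R * R * R)) (t : R) : R :=
  \sum_(q <- s) q.1.1 * (q.1.2 < t <= q.2)%R%:R.
Definition step_int (e x : V) (s : seq (R * R * R)) : V :=
  \sum_(q <- s) q.1.1 *: (spectral e x q.1.2 - spectral e x q.2).

(* phi(x) = \int phi dE_t e, the Daniell extension of the integral of step
   functions; for continuous phi >= 0, the steps below phi increase to phi. *)
Definition fun_calc (e : V) (phi : R -> R) (x : V) : V :=
  supremum 0 [set step_int e x s
             | s in [set s | step_wf s /\ forall t, step_fun s t <= phi t]].

(* x^p for x >= 0 and p > 0. The maximum is needed since the library function
   takes the value 1 at negative arguments. *)
Definition rpow (e x : V) (p : R) : V :=
  fun_calc e (fun t => Num.max t 0 `^ p) x.

End RieszSpaces.

Arguments laterally_complete {R} V.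
Arguments universally_complete {R} V.

Section NaturalDomain.
Context {R : realType} {E U : rieszType R}.
Implicit Types (iota : E -> U).

(* U is a universal completion of E, with canonical embedding iota. *)
Definition universal_completion iota : Prop :=
  [/\ universally_complete U,
      forall (c : R) x y, iota (c *: x + y) = c *: iota x + iota y,
      forall x y, iota (rjoin x y) = rjoin (iota x) (iota y) /\
                  iota (rmeet x y) = rmeet (iota x) (iota y),
      injective iota
    & forall u : U, 0 < u -> exists2 x : E, 0 < x & iota x <= u].

(* D is an upwards directed subset of E_+ increasing to f in U and with T1(D)
   order bounded in U. *)
Definition dom_net iota (T1 : E -> E) (D : set E) (f : U) : Prop :=
  [/\ forall x, D x -> 0 <= x,
      up_directed D,
      isLub (iota @` D) f
    & has_ubound ((iota \o T1) @` D)].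

Definition dom iota (T1 : E -> E) : set U :=
  [set f | 0 <= f /\ exists D, dom_net iota T1 D f].

Definition L1 iota (T1 : E -> E) : set U :=
  [set x | exists f g, [/\ dom iota T1 f, dom iota T1 g & x = f - g]].

Definition Lp iota (T1 : E -> E) (e : E) (p : R) : set U :=
  [set x | L1 iota T1 x /\ L1 iota T1 (rpow (iota e) (rabs x) p)].

(* On dom, S f is the order limit of the increasing net iota (T1 f_alpha);
   if S is also linear on L1, this determines S on L1. *)
Definition natural_extension iota (T1 : E -> E) (S : U -> U) : Prop :=
  forall D f, dom_net iota T1 D f -> isLub ((iota \o T1) @` D) (S f).

(* Families indexed by 1, 2, 3, ... are shifted: T i stands for T_{i+1} and
   Y i for Y_{i+1}. *)
Definition martingale_difference_sequence iota (T1 : E -> E) (e : E) (p : R)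
    (Y : nat -> U) (T : nat -> U -> U) : Prop :=
  [/\ filtration (L1 iota T1) T,
      natural_extension iota T1 (T 0%N),
      forall i, Lp iota T1 e p (Y i) /\ (T i @` L1 iota T1) (Y i)
    & forall i, T i (Y i.+1) = 0].

End NaturalDomain.

(* Main.v *)
Require Import Defs.
From HB Require Import structures.
From mathcomp Require Import all_boot all_order all_algebra.
From mathcomp Require Import all_classical all_reals all_analysis.
From mathcomp Require Import ring lra.
Import Order.TTheory GRing.Theory Num.Theory numFieldNormedType.Exports.
Local Open Scope classical_set_scope.
Local Open Scope ring_scope.

Set Implicit Arguments.
Unset Strict Implicit.
Unset Printing Implicit Defensive.

(** Put y_i = Y_i / a_i.  For real s >= 0 and a > 0 one has
      s^2 / a^2 <= s^p / a^gamma + a^(2 (gamma - p) / (p - 2)),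
    because one of the two terms on the right dominates alone, according to
    which of s^(p-2) and a^(gamma-2) is larger ([sq_le_power]).  The hypothesis
    relating p, gamma and k says that the last exponent is at most -k, so the
    last terms are summable along (a_i).  Hence the sums of T_1(y_i^2) are
    bounded in U, that is, the partial sums Z_n of the y_i form an L^2-bounded
    martingale.  Such a martingale converges in order ([martingale_order_cvg]),
    and Kronecker's lemma ([kronecker]) turns the convergence of the sum of the
    y_i into the statement.  Moments of order 2 are enough.

    Three points need an argument of their own in a Riesz space.

    Squares.  The product of the f-algebra U is symmetrized, which keeps all
    that matters here and saves the proof that it is commutative.  The key
    fact is that x^2 is the supremum of the affine functions 2tx - t^2 e of x,
    t real ([sq_lub]).  So a bound on squares can be checked on affine minorants.
    This transfers the inequality on reals to the power |Y_i|^p, which is given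
    by integration of step functions against a spectral system ([sq_le_rpow]),
    and it yields the Kadison-Schwarz inequality T(x)^2 <= T(x^2)
    ([condexp_sq_ge]).  Polarizing the latter gives T(xy) = x T(y) for x in the
    range of T ([condexp_pull_out]), hence the orthogonality of martingale
    increments.

    Maximal inequality.  Stopping times are avoided.  If M is the running
    maximum of X, the disjointness of M_(n+1) - M_n and M_(n+1) - X_(n+1) gives
    a pathwise bound of M_n^2 by a multiple of M_n X_n minus a stochastic
    integral ([doob_pathwise]), and taking conditional expectations one gets
    T_1(M_n^2) <= 4 T_1(X_n^2) ([doob_maximal]).

    Existence of suprema.  A set is bounded in the universally complete space U
    as soon as it is bounded on each of an increasing sequence of components
    filling up the unit ([laterally_bounded]).  For an increasing positive
    sequence with bounded conditional expectations these components are the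
    places where the whole sequence stays below j, and they fill up the unit by
    Markov's inequality and strict positivity ([condexp_bounded]).  So the
    maximal increments of (Z_n) after time m have a supremum G_m; the maximal
    inequality forces G_m to decrease to 0, and (Z_n) is Cauchy in order. *)

(** * A decision procedure for linear identities *)

Section LinearTerms.
Context {R : realType} {V : lmodType R}.

(** Syntax of linear combinations: an identity between two of them holds in any
    module as soon as the coefficients of each atom agree, and these are
    identities in the scalars. *)
Inductive lterm :=
  | LAtom of nat
  | LZero
  | LAdd of lterm & lterm
  | LOpp of lterm
  | LScale of R & lterm
  | LMuln of lterm & nat.

Fixpoint leval (env : seq V) t : V :=
  match t with
  | LAtom n => nth 0 env n
  | LZero => 0
  | LAdd t u => leval env t + leval env u
  | LOpp t => - leval env t
  | LScale c t => c *: leval env t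
  | LMuln t n => leval env t *+ n
  end.

Fixpoint lcoef (i : nat) t : R :=
  match t with
  | LAtom n => if eqn i n then 1 else 0
  | LZero => 0
  | LAdd t u => lcoef i t + lcoef i u
  | LOpp t => - lcoef i t
  | LScale c t => c * lcoef i t
  | LMuln t n => lcoef i t *+ n
  end.

Fixpoint same_lcoef (n : nat) t u : Prop :=
  if n is m.+1 then lcoef m t = lcoef m u /\ same_lcoef m t u else True.

Lemma leval_lcoef env t :
  leval env t = \sum_(i < size env) lcoef i t *: nth 0 env i.
Proof.
elim: t => [n||t IHt u IHu|t IHt|c t IHt|t IHt n] /=.
- have [lt_n|le_n] := ltnP n (size env).
    rewrite (bigD1 (Ordinal lt_n)) //= big1 ?addr0.
      by rewrite -eqE eqxx scale1r.
    move=> i; rewrite -val_eqE /= => /negbTE ne_in.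
    by rewrite -eqE /= ne_in scale0r.
  rewrite nth_default // big1 // => i _; rewrite -eqE /=.
  by rewrite ltn_eqF ?scale0r //; apply: leq_trans le_n.
- by rewrite big1 // => i _; rewrite scale0r.
- by rewrite IHt IHu -big_split; apply: eq_bigr => i _; rewrite scalerDl.
- by rewrite IHt -sumrN; apply: eq_bigr => i _; rewrite scaleNr.
- by rewrite IHt scaler_sumr; apply: eq_bigr => i _; rewrite scalerA.
- by rewrite IHt -sumrMnl; apply: eq_bigr => i _; rewrite scalerMnl.
Qed.

Lemma leval_eq env t u : same_lcoef (size env) t u -> leval env t = leval env u.
Proof.
move=> tu; rewrite !leval_lcoef; apply: eq_bigr => i _; congr (_ *: _).
elim: (size env) tu (nat_of_ord i) (ltn_ord i) => // n IHn [eq_n /IHn tu] j.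
by rewrite ltnS leq_eqVlt => /predU1P [-> //|/tu].
Qed.

End LinearTerms.

Ltac lmember x l :=
  lazymatch l with
  | nil => constr:(false)
  | cons x _ => constr:(true)
  | cons _ ?l' => lmember x l'
  end.

Ltac latoms t l :=
  lazymatch t with
  | @GRing.add _ ?a ?b => let l1 := latoms a l in latoms b l1
  | @GRing.opp _ ?a => latoms a l
  | @GRing.scale _ _ _ ?a => latoms a l
  | @GRing.natmul _ ?a _ => latoms a l
  | @GRing.zero _ => l
  | _ => lazymatch lmember t l with
         | true => l
         | false => constr:(cons t l)
         end
  end.

Ltac lindex x l :=
  lazymatch l with
  | cons x _ => constr:(O)
  | cons _ ?l' => let n := lindex x l' in constr:(S n)
  end.

Ltac lreify R t l :=
  lazymatch t with
  | @GRing.add _ ?a ?b =>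
      let ta := lreify R a l in let tb := lreify R b l in
      constr:(@LAdd R ta tb)
  | @GRing.opp _ ?a => let ta := lreify R a l in constr:(@LOpp R ta)
  | @GRing.scale _ _ ?c ?a => let ta := lreify R a l in constr:(@LScale R c ta)
  | @GRing.natmul _ ?a ?n => let ta := lreify R a l in constr:(@LMuln R ta n)
  | @GRing.zero _ => constr:(@LZero R)
  | _ => let n := lindex t l in constr:(@LAtom R n)
  end.

(** Proves an equation in V by comparing the coefficients of its maximal
    non-linear subterms; what [lra] does not settle is left as scalar goals. *)
Ltac lmod_with R V :=
  lazymatch goal with
  | |- @eq _ ?a ?b =>
      let l0 := constr:(@nil (GRing.Lmodule.sort V)) in
      let l1 := latoms a l0 in
      let l := latoms b l1 in
      let ta := lreify R a l in
      let tb := lreify R b l in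
      change (@leval R V l ta = @leval R V l tb);
      apply: leval_eq;
      cbv [same_lcoef lcoef size eqn];
      repeat split; try (by []); try lra
  end.

(** * Lattice operations in a Riesz space *)

Section RieszBasics.
Context {R : realType} {V : rieszType R}.
Implicit Types (x y z u v w : V) (c : R).

Local Ltac lmod := lmod_with R V.

(** With [lmod], this derives any inequality that is a linear rearrangement of
    a known one. *)
Lemma rle_lin x y x' y' : y - x = y' - x' -> x <= y -> x' <= y'.
Proof.
move=> eq_d le_xy.
have -> : x' = x + (x' - x) by lmod.
have -> : y' = y + (x' - x).
  have -> : y' = x' + (y' - x') by lmod.
  by rewrite -eq_d; lmod.
exact: riesz_lerD2r.
Qed.

Lemma rsub_ge0 x y : 0 <= y - x <-> x <= y.
Proof. by split; apply: rle_lin; lmod. Qed.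


Lemma rle_add x y u v : x <= y -> u <= v -> x + u <= y + v.
Proof.
move=> le_xy le_uv; apply: (le_trans (riesz_lerD2r u _ _ le_xy)).
by apply: rle_lin le_uv; lmod.
Qed.

Lemma radd_ge0 x y : 0 <= x -> 0 <= y -> 0 <= x + y.
Proof. by move=> x0 y0; rewrite -[0]addr0; apply: rle_add. Qed.

Lemma rle_opp x y : x <= y -> - y <= - x.
Proof. by apply: rle_lin; lmod. Qed.

Lemma rle_scale c x y : 0 <= c -> x <= y -> c *: x <= c *: y.
Proof.
move=> c0 /rsub_ge0 /(riesz_scaler_ge0 _ _ c0) h.
by apply/rsub_ge0; rewrite -scalerBr.
Qed.

Lemma rle_scalel c d x : 0 <= x -> c <= d -> c *: x <= d *: x.
Proof.
move=> x0; rewrite -subr_ge0 => /riesz_scaler_ge0 /(_ x0) h.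
by apply/rsub_ge0; rewrite -scalerBl.
Qed.

Lemma rscale_le c x y : 0 < c -> c *: x <= c *: y -> x <= y.
Proof.
move=> c0 /(@rle_scale c^-1); rewrite invr_ge0 => /(_ (ltW c0)).
by rewrite !scalerA mulVf ?gt_eqF// !scale1r.
Qed.

Lemma rmuln_ge0 n x : 0 <= x -> 0 <= x *+ n.
Proof. by move=> x0; rewrite -scaler_nat; apply: riesz_scaler_ge0. Qed.

Lemma rle_sum (I : eqType) (r : seq I) (P : pred I) (F G : I -> V) :
  (forall i, i \in r -> P i -> F i <= G i) ->
  \sum_(i <- r | P i) F i <= \sum_(i <- r | P i) G i.
Proof.
move=> FG; rewrite big_seq_cond [X in _ <= X]big_seq_cond.
elim/big_ind2: _ => // [x y u v|i /andP[]]; [exact: rle_add|exact: FG].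
Qed.

Lemma rjoin_ubl x y : x <= rjoin x y.
Proof. by have := lexx (rjoin x y); rewrite riesz_leUx => /andP[]. Qed.
Lemma rjoin_ubr x y : y <= rjoin x y.
Proof. by have := lexx (rjoin x y); rewrite riesz_leUx => /andP[]. Qed.
Lemma rmeet_lbl x y : rmeet x y <= x.
Proof. by have := lexx (rmeet x y); rewrite riesz_lexI => /andP[]. Qed.
Lemma rmeet_lbr x y : rmeet x y <= y.
Proof. by have := lexx (rmeet x y); rewrite riesz_lexI => /andP[]. Qed.
Lemma rjoin_le x y z : x <= z -> y <= z -> rjoin x y <= z.
Proof. by rewrite riesz_leUx => -> ->. Qed.
Lemma rle_meet x y z : z <= x -> z <= y -> z <= rmeet x y.
Proof. by rewrite riesz_lexI => -> ->. Qed.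

Lemma rjoinC x y : rjoin x y = rjoin y x.
Proof. by apply: le_anti; rewrite !riesz_leUx !rjoin_ubl !rjoin_ubr. Qed.
Lemma rmeetC x y : rmeet x y = rmeet y x.
Proof. by apply: le_anti; rewrite !riesz_lexI !rmeet_lbl !rmeet_lbr. Qed.

Lemma rmeet_le2 x y u v : x <= u -> y <= v -> rmeet x y <= rmeet u v.
Proof.
move=> xu yv; apply: rle_meet.
  exact: le_trans (rmeet_lbl _ _) xu.
exact: le_trans (rmeet_lbr _ _) yv.
Qed.
Lemma rjoin_le2 x y u v : x <= u -> y <= v -> rjoin x y <= rjoin u v.
Proof.
move=> xu yv; apply: rjoin_le.
  exact: le_trans xu (rjoin_ubl _ _).
exact: le_trans yv (rjoin_ubr _ _).
Qed.

Lemma rmeet_l x y : x <= y -> rmeet x y = x.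
Proof.
by move=> xy; apply: le_anti; rewrite rmeet_lbl riesz_lexI lexx xy.
Qed.
Lemma rjoin_l x y : y <= x -> rjoin x y = x.
Proof.
by move=> xy; apply: le_anti; rewrite rjoin_ubl riesz_leUx lexx xy.
Qed.

Lemma rjoinD z x y : rjoin (x + z) (y + z) = rjoin x y + z.
Proof.
apply: le_anti; apply/andP; split.
  by apply: rjoin_le; apply: riesz_lerD2r; [apply: rjoin_ubl|apply: rjoin_ubr].
have h : rjoin x y <= rjoin (x + z) (y + z) - z.
  apply: rjoin_le.
    by apply: rle_lin (rjoin_ubl (x + z) (y + z)); lmod.
  by apply: rle_lin (rjoin_ubr (x + z) (y + z)); lmod.
by apply: rle_lin h; lmod.
Qed.

Lemma rmeet_joinN x y : rmeet x y = - rjoin (- x) (- y).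
Proof.
apply: le_anti; apply/andP; split.
  rewrite -[rmeet x y]opprK; apply: rle_opp; apply: rjoin_le; apply: rle_opp.
    exact: rmeet_lbl.
  exact: rmeet_lbr.
apply: rle_meet; rewrite -[X in _ <= X]opprK; apply: rle_opp.
  exact: rjoin_ubl.
exact: rjoin_ubr.
Qed.

Lemma rmeet_join x y : rmeet x y = x + y - rjoin x y.
Proof.
rewrite rmeet_joinN.
have -> : - x = y + (- (x + y)) by lmod.
have -> : - y = x + (- (x + y)) by lmod.
by rewrite rjoinD rjoinC; lmod.
Qed.

Lemma rjoinZ c x y : 0 <= c -> rjoin (c *: x) (c *: y) = c *: rjoin x y.
Proof.
rewrite le_eqVlt => /predU1P[<-|c0].
  by rewrite !scale0r rjoin_l.
apply: le_anti; apply/andP; split.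
  have c0' := ltW c0; apply: rjoin_le; apply: rle_scale => //.
    exact: rjoin_ubl.
  exact: rjoin_ubr.
apply: (@rscale_le c^-1); rewrite ?invr_gt0// scalerA mulVf ?gt_eqF// scale1r.
apply: rjoin_le; apply: (@rscale_le c) => //.
  by rewrite scalerA mulfV ?gt_eqF// scale1r rjoin_ubl.
by rewrite scalerA mulfV ?gt_eqF// scale1r rjoin_ubr.
Qed.

Definition rpos x := rjoin x 0.

Lemma rpos_ge0 x : 0 <= rpos x. Proof. exact: rjoin_ubr. Qed.
Lemma rpos_ge x : x <= rpos x. Proof. exact: rjoin_ubl. Qed.
Lemma rpos_id x : 0 <= x -> rpos x = x. Proof. exact: rjoin_l. Qed.
Lemma rpos_le x y : x <= y -> 0 <= y -> rpos x <= y.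
Proof. exact: rjoin_le. Qed.
Lemma rle_rpos x y : x <= y -> rpos x <= rpos y.
Proof. by move=> xy; apply: rjoin_le2. Qed.

Lemma rposBneg x : x = rpos x - rpos (- x).
Proof.
rewrite /rpos; have := rjoinD x (- x) 0.
by rewrite addNr add0r rjoinC => ->; lmod.
Qed.

Lemma rposNE x : rpos (- x) = rpos x - x.
Proof. by rewrite {3}[x]rposBneg; lmod. Qed.

Lemma rpos_disj x : rmeet (rpos x) (rpos (- x)) = 0.
Proof.
rewrite rposNE rmeet_join.
have h := rjoinD (rpos x) 0 (- x).
rewrite add0r in h.
have -> : rjoin (rpos x) (rpos x - x) = rpos (- x) + rpos x.
  by rewrite [rpos x - x]addrC h /rpos [rjoin 0 _]rjoinC.
by rewrite rposNE; lmod.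
Qed.

Lemma rabsE x : rabs x = rpos x + rpos (- x).
Proof.
rewrite /rabs rposNE /rpos.
have h := rjoinD (- x) (x *+ 2) 0.
rewrite add0r in h; have {h} -> : rjoin x (- x) = rjoin (x *+ 2) 0 - x.
  by rewrite -h; congr rjoin; lmod.
have := @rjoinZ 2 x 0 (ler0n _ _).
by rewrite scaler0 !scaler_nat => ->; lmod.
Qed.

Lemma rabs_ge0 x : 0 <= rabs x.
Proof. by rewrite rabsE; apply: radd_ge0; apply: rpos_ge0. Qed.
Lemma rle_abs x : x <= rabs x. Proof. exact: rjoin_ubl. Qed.
Lemma rleN_abs x : - x <= rabs x. Proof. exact: rjoin_ubr. Qed.
Lemma rabs_le x y : x <= y -> - x <= y -> rabs x <= y.
Proof. exact: rjoin_le. Qed.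
Lemma rabs_id x : 0 <= x -> rabs x = x.
Proof.
move=> x0; apply: rjoin_l; apply: le_trans (x0).
by have := rle_opp x0; rewrite oppr0.
Qed.
Lemma rabsN x : rabs (- x) = rabs x.
Proof. by rewrite /rabs opprK rjoinC. Qed.
Lemma rabsD x y : rabs (x + y) <= rabs x + rabs y.
Proof.
apply: rabs_le; first by apply: rle_add; apply: rle_abs.
by rewrite opprD; apply: rle_add; apply: rleN_abs.
Qed.
Lemma rabsZ c x : 0 <= c -> rabs (c *: x) = c *: rabs x.
Proof. by move=> c0; rewrite /rabs -scalerN rjoinZ. Qed.
Lemma rpos_le_abs x : rpos x <= rabs x.
Proof. by apply: rpos_le; [apply: rle_abs|apply: rabs_ge0]. Qed.

Lemma rmeet_ge0 x y : 0 <= x -> 0 <= y -> 0 <= rmeet x y.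
Proof. exact: rle_meet. Qed.

Lemma rmeetD_le x y z : 0 <= x -> 0 <= y -> 0 <= z ->
  rmeet x (y + z) <= rmeet x y + rmeet x z.
Proof.
move=> x0 y0 z0; set m := rmeet x (y + z).
have mx : m <= x by apply: rmeet_lbl.
have myz : m <= y + z by apply: rmeet_lbr.
suff h : m - rmeet x y <= rmeet x z by apply: rle_lin h; lmod.
apply: rle_meet.
  by apply: rle_lin (rle_add mx (rmeet_ge0 x0 y0)); lmod.
suff h : m - z <= rmeet x y by apply: rle_lin h; lmod.
apply: rle_meet; first by apply: rle_lin (rle_add mx z0); lmod.
by apply: rle_lin myz; lmod.
Qed.

Lemma disj_le x y u v : 0 <= u -> 0 <= v -> u <= x -> v <= y ->
  rmeet x y = 0 -> rmeet u v = 0.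
Proof.
move=> u0 v0 ux vy xy; apply: le_anti; rewrite rmeet_ge0 // andbT.
by rewrite -xy; apply: rmeet_le2.
Qed.

Lemma disjD x y z : 0 <= x -> 0 <= y -> 0 <= z ->
  rmeet x y = 0 -> rmeet x z = 0 -> rmeet x (y + z) = 0.
Proof.
move=> x0 y0 z0 xy xz; apply: le_anti; rewrite rmeet_ge0 ?radd_ge0// andbT.
by apply: le_trans (rmeetD_le x0 y0 z0) _; rewrite xy xz addr0.
Qed.

Lemma disj_muln x y n : 0 <= x -> 0 <= y -> rmeet x y = 0 ->
  rmeet x (y *+ n) = 0.
Proof.
move=> x0 y0 xy; elim: n => [|n IH]; first by rewrite rmeetC rmeet_l.
by rewrite mulrS disjD // rmuln_ge0.
Qed.

Lemma disjZ c x y : 0 <= c -> 0 <= x -> 0 <= y -> rmeet x y = 0 ->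
  rmeet x (c *: y) = 0.
Proof.
move=> c0 x0 y0 xy.
apply: (@disj_le x (y *+ (Num.truncn c).+1)) => //.
- exact: riesz_scaler_ge0.
- rewrite -scaler_nat; apply: rle_scalel => //.
  by rewrite ltW // truncnS_gt.
- exact: disj_muln.
Qed.

Lemma disj_self x : rmeet x x = 0 -> x = 0.
Proof. by rewrite rmeet_l. Qed.

(** Infinite distributivity: a = (y /\ a) + (y \/ a) - y, where y \/ a is at most
    y \/ s, so that s is bounded by the corresponding expression. *)
Lemma rmeet_sup (A : set V) s y w : isLub A s ->
  (forall a, A a -> rmeet y a <= w) -> rmeet y s <= w.
Proof.
move=> [ub lub] h.
have : s <= w + rjoin y s - y.
  apply: lub => a Aa; have := h a Aa; rewrite rmeet_join => ha.
  have hj : rjoin y a <= rjoin y s by apply: rjoin_le2 => //; apply: ub.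
  by apply: rle_lin (rle_add ha hj); lmod.
by rewrite rmeet_join; apply: rle_lin; lmod.
Qed.

Lemma disj_sup (A : set V) s y : 0 <= y -> 0 <= s -> isLub A s ->
  (forall a, A a -> rmeet y a = 0) -> rmeet y s = 0.
Proof.
move=> y0 s0 As h; apply: le_anti; rewrite rmeet_ge0 // andbT.
by apply: rmeet_sup As _ => a /h ->.
Qed.

End RieszBasics.


(** * Dedekind completeness and the Archimedean property *)

Section Archimedean.
Context {R : realType} {V : rieszType R}.
Hypothesis Vdc : dedekind_complete [set: V].
Implicit Types (x y z w b : V).

Local Ltac lmod := lmod_with R V.

Lemma lub_exists (A : set V) : A !=set0 -> has_ubound A -> exists s, isLub A s.
Proof.
move=> A0 [u Au]; have [//|//||s [_ us ls]] := @Vdc A; first by exists u.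
by exists s; split=> // b; apply: ls.
Qed.

Lemma glb_exists (A : set V) :
  A !=set0 -> has_lbound A -> exists s, infimums A s.
Proof.
move=> [a Aa] lA.
have [|s [us ls]] := @lub_exists (lbound A) lA.
  by exists a => l; apply.
by exists s; split=> // x Ax; apply: ls => l; apply.
Qed.

(** If s is the supremum of the multiples of x, then s - x is another bound. *)
Lemma archimedean x y : (forall n : nat, n%:R *: x <= y) -> x <= 0.
Proof.
move=> h; have [||s [us ls]] := @lub_exists (range (fun n : nat => n%:R *: x)).
- by exists (0%:R *: x), 0%N.
- by exists y => _ [n _ <-].
have : s <= s - x.
  apply: ls => _ [n _ <-].
  have := us (n.+1%:R *: x) (ex_intro2 _ _ n.+1 I erefl).
  by rewrite -natr1; apply: rle_lin; lmod.
by apply: rle_lin; lmod.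
Qed.

Lemma archimedean_eps x y : (forall n : nat, x <= n.+1%:R^-1 *: y) -> x <= 0.
Proof.
move=> h; apply: (@archimedean _ (rabs y)) => -[|n].
  by rewrite scale0r rabs_ge0.
apply: le_trans (rle_abs y).
have := @rle_scale _ _ n.+1%:R _ _ (ler0n _ _) (h n).
by rewrite scalerA mulfV ?pnatr_eq0// scale1r.
Qed.

(** A real line that stays below y is constant; this is how a nonnegative
    quadratic polynomial with no leading coefficient loses its linear term. *)
Lemma archimedean_lin x y : (forall t : R, t *: x <= y) -> x = 0.
Proof.
move=> h; apply: le_anti; rewrite (@archimedean x y (fun n => h n%:R)) /=.
have /rle_opp : - x <= 0.
  by apply: (@archimedean _ y) => n; rewrite scalerN -scaleNr.
by rewrite opprK oppr0.
Qed.

End Archimedean.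

(** * Unital products and squares *)

Section Product.
Context {R : realType} {V : rieszType R}.
Implicit Types (x y z w b : V).

(** The axioms of a commutative f-algebra with unit e that survive the
    symmetrization [jordan] of its product. *)
Record unital_product (e : V) (dot : V -> V -> V) : Prop := UnitalProduct {
  dotC : forall x y, dot x y = dot y x ;
  dot_linear : forall (c : R) x y z, dot (c *: x + y) z = c *: dot x z + dot y z ;
  dot_ge0 : forall x y, 0 <= x -> 0 <= y -> 0 <= dot x y ;
  dot_disj : forall x y z, rmeet x y = 0 -> 0 <= z -> rmeet (dot z x) y = 0 ;
  dot1 : forall x, dot e x = x
}.

(** The symmetrization makes commutativity, a theorem for Archimedean
    f-algebras, hold by construction. *)
Definition jordan (mul : V -> V -> V) x y : V := 2^-1 *: (mul x y + mul y x).

Lemma jordan_unital (mul : V -> V -> V) e :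
  f_algebra_with_unit mul e -> unital_product e (jordan mul).
Proof.
move=> [[mulDl mulDr _] mul0 muld mul1]; split.
- by move=> x y; rewrite /jordan addrC.
- move=> c x y z; rewrite /jordan mulDl mulDr.
  by lmod_with R V.
- move=> x y x0 y0; apply: riesz_scaler_ge0; first by rewrite invr_ge0.
  by apply: radd_ge0; apply: mul0.
- move=> x y z xy z0.
  have x0 : 0 <= x by rewrite -xy; apply: rmeet_lbl.
  have y0 : 0 <= y by rewrite -xy; apply: rmeet_lbr.
  have [d1 d2] := muld _ _ _ xy z0.
  rewrite rmeetC; apply: disjZ => //.
    by apply: radd_ge0; apply: mul0.
  by apply: disjD; rewrite ?mul0// rmeetC.
- move=> x; rewrite /jordan; have [-> ->] := mul1 x.
  by lmod_with R V.
Qed.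

Variables (e : V) (dot : V -> V -> V).
Hypothesis dotP : unital_product e dot.

Local Ltac lmod := lmod_with R V.

Lemma dotDl x y z : dot (x + y) z = dot x z + dot y z.
Proof. by have := dot_linear dotP 1 x y z; rewrite !scale1r. Qed.
Lemma dot0l z : dot 0 z = 0.
Proof. by apply: (addrI (dot 0 z)); rewrite -dotDl !addr0. Qed.
Lemma dotZl (c : R) x z : dot (c *: x) z = c *: dot x z.
Proof. by have := dot_linear dotP c x 0 z; rewrite dot0l !addr0. Qed.
Lemma dotNl x z : dot (- x) z = - dot x z.
Proof. by rewrite -scaleN1r dotZl scaleN1r. Qed.
Lemma dotDr x y z : dot z (x + y) = dot z x + dot z y.
Proof. by rewrite !(dotC dotP z) dotDl. Qed.
Lemma dot0r z : dot z 0 = 0.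
Proof. by rewrite (dotC dotP) dot0l. Qed.
Lemma dotZr (c : R) x z : dot z (c *: x) = c *: dot z x.
Proof. by rewrite !(dotC dotP z) dotZl. Qed.
Lemma dotNr x z : dot z (- x) = - dot z x.
Proof. by rewrite !(dotC dotP z) dotNl. Qed.
Lemma dot1r x : dot x e = x.
Proof. by rewrite (dotC dotP) (dot1 dotP). Qed.

Definition dotE := (dotDl, dotDr, dotZl, dotZr, dotNl, dotNr).

(** Multiplying x by y keeps it disjoint from y; multiplying y by x then keeps it
    disjoint from the product, which is therefore disjoint from itself. *)
Lemma dot_disj0 x y : rmeet x y = 0 -> dot x y = 0.
Proof.
move=> xy.
have x0 : 0 <= x by rewrite -xy; apply: rmeet_lbl.
have y0 : 0 <= y by rewrite -xy; apply: rmeet_lbr.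
have d1 := dot_disj dotP xy y0; rewrite rmeetC in d1.
have := dot_disj dotP d1 x0; rewrite (dotC dotP y x).
exact: disj_self.
Qed.

Lemma sq_ge0 x : 0 <= dot x x.
Proof.
have d0 := dot_disj0 (rpos_disj x).
have -> : dot x x = dot (rpos x) (rpos x) + dot (rpos (- x)) (rpos (- x)).
  rewrite {1 2}[x]rposBneg !dotE (dotC dotP (rpos (- x)) (rpos x)) d0.
  by lmod.
by apply: radd_ge0; apply: (dot_ge0 dotP); apply: rpos_ge0.
Qed.

Lemma abs_sq x : dot (rabs x) (rabs x) = dot x x.
Proof.
have d0 := dot_disj0 (rpos_disj x).
rewrite rabsE {5 6}[x]rposBneg !dotE (dotC dotP (rpos (- x)) (rpos x)) d0.
by lmod.
Qed.

Lemma unit_ge0 : 0 <= e.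
Proof. by rewrite -[e](dot1 dotP); apply: sq_ge0. Qed.

Lemma unit_scale_ge0 (c : R) : 0 <= c -> 0 <= c *: e.
Proof. by move=> c0; apply: riesz_scaler_ge0 => //; apply: unit_ge0. Qed.

Lemma disj_unit x : rmeet e x = 0 -> x = 0.
Proof. by move/dot_disj0; rewrite (dot1 dotP). Qed.

Lemma dot_le z x y : 0 <= z -> x <= y -> dot z x <= dot z y.
Proof.
move=> z0 /rsub_ge0 /(dot_ge0 dotP z0); rewrite !dotE => h.
exact/rsub_ge0.
Qed.

Lemma sq_le x y : 0 <= x -> x <= y -> dot x x <= dot y y.
Proof.
move=> x0 xy; apply: le_trans (dot_le x0 xy) _.
by rewrite (dotC dotP); apply: (dot_le _ xy); apply: le_trans x0 xy.
Qed.

(** This is the nonnegativity of the square of tx - y. *)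
Lemma dot_amgm (t : R) x y :
  (2 * t) *: dot x y <= (t ^+ 2) *: dot x x + dot y y.
Proof.
have := sq_ge0 (t *: x - y); rewrite !dotE (dotC dotP y x).
by apply: rle_lin; lmod.
Qed.

Lemma sq_unit_le (t : R) x : (2 * t) *: x - t ^+ 2 *: e <= dot x x.
Proof.
have := sq_ge0 (x - t *: e); rewrite !dotE !dot1r (dot1 dotP).
by apply: rle_lin; lmod.
Qed.

Lemma sqD x y : dot (x + y) (x + y) = (dot x x + 2 *: dot x y) + dot y y.
Proof. by rewrite !dotE (dotC dotP y x); lmod. Qed.

Lemma sqD_le x y : dot (x + y) (x + y) <= 2 *: dot x x + 2 *: dot y y.
Proof.
have := sq_ge0 (x - y); rewrite !dotE (dotC dotP y x).
by apply: rle_lin; lmod.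
Qed.

Hypothesis Vdc : dedekind_complete [set: V].

(** y /\ e is at most x / (n + 1) for every n, hence 0, and e is a weak unit. *)
Lemma disj_all_eq0 (z : nat -> V) x y : 0 <= y -> (forall n, 0 <= z n) ->
  0 <= x ->
  (forall n, rmeet y (z n) = 0) -> (forall n, e <= z n + n.+1%:R^-1 *: x) ->
  y = 0.
Proof.
move=> y0 z0 x0 yz ez; apply: disj_unit; rewrite rmeetC.
apply: le_anti; rewrite rmeet_ge0 ?unit_ge0// andbT.
apply: (archimedean_eps Vdc (y := x)) => n.
have nx0 : 0 <= n.+1%:R^-1 *: x.
  by apply: riesz_scaler_ge0 => //; rewrite invr_ge0.
apply: (le_trans (rmeet_le2 (lexx y) (ez n))).
apply: (le_trans (rmeetD_le y0 (z0 n) nx0)).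
by rewrite yz add0r; apply: rmeet_lbr.
Qed.

(** For t >= 0 the square of |x| - te is the smaller one of the squares of x - te
    and x + te, and for t < 0 it is larger than the square of |x| + te. *)
Lemma sq_shift_fold b x :
  (forall t : R, b <= dot (x - t *: e) (x - t *: e)) ->
  forall t : R, b <= dot (rabs x - t *: e) (rabs x - t *: e).
Proof.
move=> h.
have h0 (t : R) : 0 <= t -> b <= dot (rabs x - t *: e) (rabs x - t *: e).
  move=> t0; rewrite !dotE !dot1r (dot1 dotP) abs_sq.
  have : rabs ((2 * t) *: x) <= dot x x + t ^+ 2 *: e - b.
    apply: rabs_le.
      by apply: rle_lin (h t); rewrite !dotE !dot1r (dot1 dotP); lmod.
    by apply: rle_lin (h (- t)); rewrite !dotE !dot1r (dot1 dotP); lmod.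
  by rewrite rabsZ ?mulr_ge0//; apply: rle_lin; lmod.
move=> t; have [/h0//|/ltW t0] := leP 0 t.
have t1 : 0 <= - t by rewrite oppr_ge0.
apply: (le_trans (h0 _ t1)).
have := riesz_scaler_ge0 _ _ (mulr_ge0 (ler0n R 4) t1) (rabs_ge0 x).
by apply: rle_lin; rewrite !dotE !dot1r (dot1 dotP); lmod.
Qed.

(** Folding x around C/2, then the result around C/4, and so on, gives elements
    bounded by C / 2^n e + w that still have b below the square of each shift;
    for the shift 0 this says that b is at most their squares. *)
Lemma sq_shift_le b x w (C : R) : 0 <= C -> 0 <= x -> 0 <= w ->
  x <= C *: e + w ->
  (forall t : R, b <= dot (x - t *: e) (x - t *: e)) -> b <= dot w w.
Proof.
move=> C0 x0 w0 xC hx.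
have fold n : exists y, [/\ 0 <= y, y <= (C / 2 ^+ n) *: e + w &
    forall t : R, b <= dot (y - t *: e) (y - t *: e)].
  elim: n => [|n [y [y0 yC hy]]]; first by exists x; rewrite expr0 divr1.
  (* the next folding point: half the current bound *)
  pose c := C / 2 ^+ n.+1.
  have cE : C / 2 ^+ n = 2 * c.
    by rewrite /c exprS invfM mulrCA mulVKf.
  have c0 : 0 <= c by rewrite /c divr_ge0.
  rewrite {}cE in yC; rewrite -/c; move: c c0 yC => c c0 yC.
  exists (rabs (y - c *: e)); split; first exact: rabs_ge0.
    apply: rabs_le.
      by apply: rle_lin yC; lmod.
    rewrite opprB; apply: (@le_trans _ _ (c *: e)).
      by apply: rle_lin y0; lmod.
    by apply: rle_lin w0; lmod.
  apply: sq_shift_fold => t; have := hy (c + t).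
  by rewrite scalerDl opprD addrA.
have : b - dot w w <= 0.
  apply: (archimedean Vdc (y := (C ^+ 2) *: e + (2 * C) *: w)) => n.
  have [y [y0 yC hy]] := fold n.
  pose c := C / 2 ^+ n; rewrite -/c in yC.
  have c0 : 0 <= c by rewrite /c divr_ge0.
  have n2 : n%:R <= 2 ^+ n :> R by rewrite -natrX ler_nat ltnW // ltn_expl.
  have cC : c <= C.
    rewrite ler_pdivrMr ?exprn_gt0// ler_peMr //.
    by rewrite exprn_ege1 // ler1n.
  have nc : n%:R * c <= C.
    by rewrite /c mulrCA ler_piMr // ler_pdivrMr ?exprn_gt0// mul1r.
  have := hy 0; rewrite scale0r subr0 => hb.
  have bc := le_trans hb (sq_le y0 yC).
  have bc' : b - dot w w <= (c ^+ 2) *: e + (2 * c) *: w.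
    apply: rle_lin bc; rewrite !dotE !dot1r (dot1 dotP).
    by lmod.
  apply: (le_trans (rle_scale (ler0n _ _) bc')).
  rewrite scalerDr !scalerA; apply: rle_add.
    apply: rle_scalel; first exact: unit_ge0.
    by rewrite expr2 mulrA expr2 ler_pM // mulr_ge0.
  by apply: rle_scalel => //; rewrite mulrCA ler_wpM2l.
by apply: rle_lin; lmod.
Qed.

(** Apply the previous lemma to w = (|x| - C e)^+: the positive part of b lies
    below w^2, hence is disjoint from (C e - |x|)^+, for every C. *)
Lemma sq_shift_inf b x :
  (forall t : R, b <= dot (x - t *: e) (x - t *: e)) -> b <= 0.
Proof.
move=> /sq_shift_fold h.
suff : rpos b = 0 by move=> <-; apply: rpos_ge.
have X0 := rabs_ge0 x; set X := rabs x in X0 h.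
pose z (n : nat) := n.+1%:R^-1 *: rpos (n.+1%:R *: e - X).
have n0 (n : nat) : 0 <= (n.+1%:R^-1 : R) by rewrite invr_ge0.
apply: (@disj_all_eq0 z X) => //.
- exact: rpos_ge0.
- by move=> n; apply: riesz_scaler_ge0 => //; apply: rpos_ge0.
- move=> n; apply: disjZ => //; try exact: rpos_ge0.
  set w := rpos (X - n.+1%:R *: e).
  have w0 : 0 <= w by apply: rpos_ge0.
  have bw : b <= dot w w.
    apply: (@sq_shift_le _ X _ n.+1%:R) => //.
    by have := rpos_ge (X - n.+1%:R *: e); rewrite -/w; apply: rle_lin; lmod.
  have d : rmeet w (rpos (n.+1%:R *: e - X)) = 0.
    by have := rpos_disj (X - n.+1%:R *: e); rewrite opprB.
  apply: (disj_le _ _ _ (lexx _) (dot_disj dotP d w0)); try exact: rpos_ge0.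
  by apply: rpos_le => //; apply: sq_ge0.
- move=> n; rewrite /z.
  have := @rle_scale _ _ (n.+1%:R^-1) _ _ (n0 n) (rpos_ge (n.+1%:R *: e - X)).
  rewrite scalerBr scalerA mulVf ?pnatr_eq0// scale1r.
  by apply: rle_lin; move: (n.+1%:R^-1 : R) => c; lmod.
Qed.

(** The square is the least upper bound of its tangents; [sq_unit_le] is the
    other half.  Since w - x^2 + (x - te)^2 >= 0 for all t, this is
    [sq_shift_inf]. *)
Lemma sq_lub x w :
  (forall t : R, (2 * t) *: x - t ^+ 2 *: e <= w) -> dot x x <= w.
Proof.
move=> h; apply/rsub_ge0; have /rle_opp : dot x x - w <= 0.
  apply: (@sq_shift_inf _ x) => t.
  by apply: rle_lin (h t); rewrite !dotE !dot1r (dot1 dotP); lmod.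
by rewrite oppr0 opprB.
Qed.

End Product.


(** * Components of the unit *)

Section Components.
Context {R : realType} {V : rieszType R}.
Implicit Types (x y z w b c d : V).
Variables (e : V) (dot : V -> V -> V).
Hypothesis dotP : unital_product e dot.

Local Ltac lmod := lmod_with R V.

Definition component c := rmeet c (e - c) = 0.

Lemma component_ge0 c : component c -> 0 <= c.
Proof. by move=> <-; apply: rmeet_lbl. Qed.

Lemma component_le c : component c -> c <= e.
Proof. by move=> hc; apply/rsub_ge0; rewrite -hc; apply: rmeet_lbr. Qed.

Lemma componentC c : component c -> component (e - c).
Proof. by rewrite /component => hc; rewrite subKr rmeetC. Qed.

Lemma component_sup (A : set V) s : A !=set0 -> (forall c, A c -> component c) ->
  isLub A s -> component s.
Proof.
move=> [a Aa] hA [us ls].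
have s0 : 0 <= s by apply: le_trans (us _ Aa); apply/component_ge0/hA.
have se : s <= e by apply: ls => c /hA /component_le.
rewrite /component rmeetC; apply: (@disj_sup _ _ A) => //.
  exact/rsub_ge0.
move=> c Ac; have hc := hA c Ac; rewrite rmeetC.
apply: disj_le hc => //; first exact: component_ge0 (hA _ Ac).
  exact/rsub_ge0.
by apply: rle_lin (us c Ac); lmod.
Qed.

Lemma dot_disj_dot c d x : rmeet c d = 0 -> dot c (dot d x) = 0.
Proof.
move=> cd.
have h z : 0 <= z -> dot c (dot d z) = 0.
  move=> z0; apply: (dot_disj0 dotP); rewrite rmeetC (dotC dotP).
  by apply: (dot_disj dotP) => //; rewrite rmeetC.
rewrite [x]rposBneg !(dotE dotP) !h; try exact: rpos_ge0.
by rewrite subrr.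
Qed.

(** The part of x along e - c is disjoint from c, so multiplication by c is a band
    projection. *)
Lemma component_idem c x : component c -> dot c (dot c x) = dot c x.
Proof.
move=> hc; have := dot_disj_dot x hc.
rewrite !(dotE dotP) (dot1 dotP) => /eqP.
by rewrite subr_eq0 => /eqP <-.
Qed.

Lemma disj_component_dot0 c y : component c -> 0 <= y ->
  dot c y = 0 -> rmeet c y = 0.
Proof.
move=> hc y0 cy.
have -> : y = dot y (e - c).
  by rewrite !(dotE dotP) (dot1r dotP) [dot y c](dotC dotP) cy subr0.
rewrite rmeetC; apply: (dot_disj dotP) => //.
by rewrite rmeetC.
Qed.

Lemma dot_le_unit c y : c <= e -> 0 <= y -> dot c y <= y.
Proof.
move=> ce y0; rewrite -[X in _ <= X](dot1 dotP) !(dotC dotP _ y).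
exact: (dot_le dotP).
Qed.

Lemma dot_disj_le0 c y : 0 <= c -> rmeet c (rpos y) = 0 -> dot c y <= 0.
Proof.
move=> c0 h; rewrite [y]rposBneg !(dotE dotP) (dot_disj0 dotP h) add0r.
have := rle_opp (dot_ge0 dotP c0 (rpos_ge0 (- y))).
by rewrite oppr0.
Qed.

Lemma dot_le0_disj c y : component c -> dot c y <= 0 -> rmeet c (rpos y) = 0.
Proof.
move=> hc; have c0 := component_ge0 hc.
rewrite {1}[y]rposBneg !(dotE dotP) => h.
apply: disj_component_dot0 => //; first exact: rpos_ge0.
have le : dot c (rpos y) <= dot c (rpos (- y)) by apply: rle_lin h; lmod.
have := rmeet_l le => <-.
apply: (dot_disj dotP) => //; rewrite rmeetC.
by apply: (dot_disj dotP) => //; rewrite rmeetC rpos_disj.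
Qed.

(** Cut along the disjoint components q_n = p_n - p_(n-1).  The pieces of the
    bounds w_n are pairwise disjoint, so lateral completeness gives them a
    common bound W, and x <= W can be checked on each q_n. *)
Lemma laterally_bounded (A : set V) (p w : nat -> V) :
  laterally_complete V ->
  (forall n, component (p n)) -> (forall n, p n <= p n.+1) ->
  (forall y, 0 <= y -> (forall n, rmeet (p n) y = 0) -> y = 0) ->
  (forall n x, A x -> dot (p n) x <= w n) -> has_ubound A.
Proof.
move=> lc hp incp full hA.
pose q n := if n is m.+1 then p m.+1 - p m else p 0%N.
have p0 n : 0 <= p n by apply: component_ge0.
have pmono m n : (m <= n)%N -> p m <= p n.
  move=> /subnK <-; elim: (n - m)%N => // k IH.
  exact: le_trans IH (incp _).
have q0 n : 0 <= q n by case: n => [|n] //=; apply/rsub_ge0.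
have qp n : q n <= p n.
  by case: n => [|n] //=; apply: rle_lin (p0 n); lmod.
have ep0 n : 0 <= e - p n by apply/rsub_ge0; apply: component_le.
have qSp n : rmeet (q n.+1) (p n) = 0.
  rewrite rmeetC; apply: (disj_le (p0 _) (q0 _) (lexx _) _ (hp n)).
  rewrite /=; apply: riesz_lerD2r; exact: component_le.
have qq m n : (m < n)%N -> rmeet (q m) (q n) = 0.
  case: n => // n; rewrite ltnS => mn; rewrite rmeetC.
  apply: (disj_le _ _ (lexx _) _ (qSp n)) => //.
  exact: le_trans (qp m) (pmono _ _ mn).
have hq n : component (q n).
  have eqp : rmeet (q n) (e - p n) = 0.
    exact: (disj_le _ _ (qp n) (lexx _) (hp n)).
  case: n eqp => [//|n] eqp; rewrite /component.
  have -> : e - q n.+1 = (e - p n.+1) + p n by rewrite /=; lmod.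
  exact: disjD.
pose d n := dot (q n) (rabs (w n)).
have d0 n : 0 <= d n by apply: (dot_ge0 dotP) => //; apply: rabs_ge0.
have dd m n : (m < n)%N -> rmeet (d m) (d n) = 0.
  move=> /qq mn; rewrite /d !(dotC dotP (q _)).
  apply: (dot_disj dotP) (rabs_ge0 _); rewrite rmeetC.
  by apply: (dot_disj dotP) (rabs_ge0 _); rewrite rmeetC.
have [||x y [m _ <-] [n _ <-] ne|W [uW _]] := lc (range d).
- by exists (d 0%N), 0%N.
- by move=> _ [n _ <-].
- have [mn|nm|mn] := ltngtP m n; first exact: dd.
    by rewrite rmeetC dd.
  by rewrite mn in ne.
exists W => x Ax; apply/rsub_ge0.
suff : rpos (x - W) = 0.
  have := rpos_ge (x - W) => /[swap] ->.
  by apply: rle_lin; lmod.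
apply: full => [|n]; first exact: rpos_ge0.
have qW k : rmeet (q k) (rpos (x - W)) = 0.
  apply: dot_le0_disj => //; rewrite !(dotE dotP).
  have dW : d k <= dot (q k) W.
    rewrite -[d k](component_idem _ (hq k)); apply: (dot_le dotP) => //.
    by apply: uW; exists k.
  have xd : dot (q k) x <= d k.
    have -> : dot (q k) x = dot (q k) (dot (p k) x).
      have := @dot_disj_dot (q k) (e - p k) x.
      rewrite !(dotE dotP) (dot1 dotP) => h; apply/eqP.
      rewrite -subr_eq0; apply/eqP; apply: h.
      exact: (disj_le _ _ (qp k) (lexx _) (hp k)).
    apply: (dot_le dotP) => //; apply: le_trans (rle_abs _).
    exact: hA.
  by apply: rle_lin (le_trans xd dW); lmod.
rewrite rmeetC; elim: n => [|n IH]; first by rewrite rmeetC (qW 0%N).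
have -> : p n.+1 = q n.+1 + p n by rewrite /=; lmod.
by apply: disjD => //; [apply: rpos_ge0|rewrite rmeetC qW].
Qed.

End Components.

(** * The spectral system of an element *)

Section Spectral.
Context {R : realType} {V : rieszType R}.
Implicit Types (x y z w b c d : V) (s t : R).
Variables (e : V) (dot : V -> V -> V).
Hypothesis dotP : unital_product e dot.
Hypothesis Vdc : dedekind_complete [set: V].

Local Ltac lmod := lmod_with R V.
Local Notation sigma := (spectral e).

Lemma supremum_lub (A : set V) :
  A !=set0 -> has_ubound A -> isLub A (supremum 0 A).
Proof.
move=> A0 bA; rewrite /supremum ifF; last first.
  by apply/negbTE/set0P.
have [s [us ls]] := lub_exists Vdc A0 bA.
have hs : supremums A s by split.
by have [u l] := xgetI 0 hs; split.
Qed.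

Lemma spectral_lub x t :
  isLub [set rmeet e (n%:R *: rpos (x - t *: e)) | n in [set: nat]] (sigma x t).
Proof.
apply: supremum_lub; first by exists (rmeet e (0%:R *: rpos (x - t *: e))), 0%N.
by exists e => _ [n _ <-]; apply: rmeet_lbl.
Qed.

Lemma spectral_ge0 x t : 0 <= sigma x t.
Proof.
have [us _] := spectral_lub x t.
apply: le_trans (us _ (ex_intro2 _ _ 0%N I erefl)).
by rewrite scale0r rmeet_ge0 // (unit_ge0 dotP).
Qed.

Lemma spectral_le_unit x t : sigma x t <= e.
Proof. by have [_] := spectral_lub x t; apply=> _ [n _ <-]; apply: rmeet_lbl. Qed.

(** If d is a common part of e - sigma and u = (x - te)^+, then d can be added to
    each e /\ n u and the sum stays below e /\ (n+1) u; so d + sigma <= sigma. *)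
Lemma spectral_disj x t : rmeet (e - sigma x t) (rpos (x - t *: e)) = 0.
Proof.
set u := rpos _; have u0 : 0 <= u by apply: rpos_ge0.
have [us ls] := spectral_lub x t; rewrite -/u in us ls.
set m := rmeet _ _.
have m0 : 0 <= m by apply: rmeet_ge0 => //; apply/rsub_ge0/spectral_le_unit.
apply: le_anti; rewrite m0 andbT.
suff : sigma x t <= sigma x t - m by apply: rle_lin; lmod.
apply: ls => _ [n _ <-].
suff h : m + rmeet e (n%:R *: u) <= sigma x t by apply: rle_lin h; lmod.
apply: le_trans (us _ (ex_intro2 _ _ n.+1 I erefl)).
apply: rle_meet.
  have h1 : m <= e - sigma x t by apply: rmeet_lbl.
  have h2 := us _ (ex_intro2 _ _ n I erefl).
  by apply: rle_lin (rle_add h1 h2); lmod.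
rewrite -natr1 scalerDl scale1r addrC.
by apply: rle_add; [apply: rmeet_lbr|apply: rmeet_lbr].
Qed.

Lemma spectral_disj_sup x t y : 0 <= y -> rmeet y (rpos (x - t *: e)) = 0 ->
  rmeet y (sigma x t) = 0.
Proof.
move=> y0 yu; apply: (disj_sup y0 (spectral_ge0 x t) (spectral_lub x t)).
move=> _ [n _ <-].
have nu0 : 0 <= n%:R *: rpos (x - t *: e).
  by apply: riesz_scaler_ge0 => //; apply: rpos_ge0.
apply: (@disj_le _ _ y (n%:R *: rpos (x - t *: e))) => //.
- by apply: rmeet_ge0 => //; apply: (unit_ge0 dotP).
- exact: rmeet_lbr.
- by apply: disjZ => //; apply: rpos_ge0.
Qed.

Lemma spectral_component x t : component e (sigma x t).
Proof.
rewrite /component rmeetC; apply: spectral_disj_sup; last exact: spectral_disj.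
exact/rsub_ge0/spectral_le_unit.
Qed.

Lemma spectral_dot_ge0 x t : 0 <= dot (sigma x t) (x - t *: e).
Proof.
have h := rpos_disj (x - t *: e); rewrite rmeetC in h.
have := spectral_disj_sup (rpos_ge0 _) h; rewrite rmeetC.
rewrite -[rpos _](opprK) => h2.
have -> : x - t *: e = - (- (x - t *: e)) by rewrite opprK.
rewrite (dotNr dotP) -[0]oppr0; apply: rle_opp.
apply: (dot_disj_le0 dotP); first exact: spectral_ge0.
by rewrite opprK in h2.
Qed.

Lemma spectral_compl_dot_le0 c x t : 0 <= c -> c <= e - sigma x t ->
  dot c (x - t *: e) <= 0.
Proof.
move=> c0 ce; apply: (dot_disj_le0 dotP) => //.
exact: disj_le (rpos_ge0 _) ce (lexx _) (spectral_disj x t).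
Qed.

(** Markov's inequality: on the component sigma, x is at least t. *)
Lemma spectral_markov x t : 0 <= x -> t *: sigma x t <= x.
Proof.
move=> x0; have := spectral_dot_ge0 x t.
rewrite !(dotE dotP) (dot1r dotP) => h.
apply: le_trans (dot_le_unit dotP (spectral_le_unit x t) x0).
by apply: rle_lin h; lmod.
Qed.

Lemma spectral_mono x y s t : x - s *: e <= y - t *: e ->
  sigma x s <= sigma y t.
Proof.
move=> le; have [_ ls] := spectral_lub x s; have [us _] := spectral_lub y t.
apply: ls => _ [n _ <-].
apply: le_trans (us _ (ex_intro2 _ _ n I erefl)).
by apply: rmeet_le2 => //; apply: rle_scale => //; apply: rle_rpos.
Qed.

Lemma spectral_decr x s t : s <= t -> sigma x t <= sigma x s.
Proof.
move=> st; apply: spectral_mono.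
have := rle_scalel (unit_ge0 dotP) st.
by apply: rle_lin; lmod.
Qed.

(** By Markov's inequality, e - sigma x n exhausts e up to x / n. *)
Lemma spectral_full x y : 0 <= x -> 0 <= y ->
  (forall n : nat, rmeet y (e - sigma x n.+1%:R) = 0) -> y = 0.
Proof.
move=> x0 y0 h.
apply: (disj_all_eq0 dotP Vdc (z := fun n => e - sigma x n.+1%:R) y0 _ x0 h).
  by move=> n; apply/rsub_ge0/spectral_le_unit.
move=> n.
have n0 : 0 <= (n.+1%:R^-1 : R) by rewrite invr_ge0.
have := rle_scale n0 (spectral_markov n.+1%:R x0).
rewrite scalerA mulVf ?pnatr_eq0// scale1r.
by move: (n.+1%:R^-1 : R) => c; apply: rle_lin; lmod.
Qed.

End Spectral.


(** * Functional calculus by step functions *)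

Section StepIntegral.
Context {R : realType} {V : rieszType R}.
Implicit Types (x y z w b c d : V) (s : seq (R * R * R)) (r : seq R).

Local Ltac lmod := lmod_with R V.

Lemma sorted_consecutive r k i : sorted <=%R r -> k \in r ->
  (i.+1 < size r)%N -> r`_i.+1 <= k \/ k <= r`_i.
Proof.
move=> sr kr ir; have := nth_index 0 kr.
have kz : (index k r < size r)%N by rewrite index_mem.
have mono := sorted_leq_nth le_trans (@lexx _ _) 0 sr.
move=> <-; case: (leqP i.+1 (index k r)) => [le|].
  by left; apply: mono; rewrite ?inE.
by rewrite ltnS => le; right; apply: mono; rewrite ?inE// ltnW.
Qed.

(** Each summand on the right is the increment of f between two consecutive
    breakpoints truncated to [a, b]: no interval of the partition r crosses a or
    b.  The sum of these increments telescopes. *)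
Lemma interval_refine (f : R -> V) r (a b : R) : sorted <=%R r -> a <= b ->
  a \in r -> b \in r ->
  f a - f b = \sum_(0 <= i < (size r).-1)
    ((a < r`_i.+1 <= b)%R%:R : R) *: (f r`_i - f r`_i.+1).
Proof.
move=> sr ab ar br.
pose clamp t := Num.max a (Num.min t b).
have r0 : (0 < size r)%N by case: r ar {sr br}.
have mono := sorted_leq_nth le_trans (@lexx _ _) 0 sr.
transitivity (\sum_(0 <= i < (size r).-1) (f (clamp r`_i) - f (clamp r`_i.+1))).
  under eq_bigr do rewrite -opprB.
  rewrite sumrN telescope_sumr // opprB.
  have lo : r`_0 <= a.
    by rewrite -(nth_index 0 ar); apply: mono; rewrite ?inE// index_mem.
  have hi : b <= r`_(size r).-1.
    rewrite -(nth_index 0 br); apply: mono; rewrite ?inE ?index_mem ?prednK//.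
    by rewrite -ltnS prednK // index_mem.
  congr (f _ - f _); rewrite /clamp.
    by rewrite min_l ?(le_trans lo)// max_l.
  by rewrite min_r // max_r.
apply: eq_big_nat => i /andP[_ ir].
have {}ir : (i.+1 < size r)%N by rewrite -ltn_predRL.
have ii : r`_i <= r`_i.+1 by apply: mono; rewrite ?inE// ltnW.
have [ha|ha] := sorted_consecutive sr ar ir.
  have c1 : clamp r`_i = a by rewrite /clamp max_l // ge_min (le_trans ii).
  have c2 : clamp r`_i.+1 = a by rewrite /clamp max_l // ge_min ha.
  by rewrite c1 c2 subrr ltNge ha /= scale0r.
have [hb|hb] := sorted_consecutive sr br ir.
  have c1 : clamp r`_i = r`_i.
    by rewrite /clamp min_l ?(le_trans ii)// max_r.
  have c2 : clamp r`_i.+1 = r`_i.+1.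
    by rewrite /clamp min_l // max_r // (le_trans ha).
  rewrite c1 c2 hb andbT; have [_|le] := ltP a r`_i.+1; first by rewrite scale1r.
  have -> : r`_i.+1 = r`_i.
    by apply: le_anti; rewrite ii andbT (le_trans le).
  by rewrite subrr scaler0.
have c1 : clamp r`_i = b by rewrite /clamp min_r // max_r.
have c2 : clamp r`_i.+1 = b.
  by rewrite /clamp min_r ?(le_trans hb)// max_r.
rewrite c1 c2 subrr; have [le|] := leP r`_i.+1 b; last by rewrite andbF scale0r.
have -> : r`_i.+1 = r`_i by apply: le_anti; rewrite ii andbT (le_trans le).
by rewrite subrr scaler0.
Qed.

Lemma step_int_refine (e x : V) s r : sorted <=%R r -> step_wf s ->
  (forall q, q \in s -> (q.1.2 \in r) && (q.2 \in r)) ->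
  step_int e x s = \sum_(0 <= i < (size r).-1)
    step_fun s r`_i.+1 *: (spectral e x r`_i - spectral e x r`_i.+1).
Proof.
move=> sr /allP wf sub; rewrite /step_int /step_fun.
under [RHS]eq_bigr do rewrite scaler_suml.
rewrite exchange_big; apply: eq_big_seq => q qs.
have /andP[q1 q2] := sub q qs.
rewrite (interval_refine (spectral e x) sr (wf _ qs) q1 q2) scaler_sumr.
by apply: eq_bigr => i _; rewrite scalerA.
Qed.

Variables (e : V) (dot : V -> V -> V).
Hypothesis dotP : unital_product e dot.
Hypothesis Vdc : dedekind_complete [set: V].
Local Notation sigma := (spectral e).

(** Add k to the breakpoints.  Intervals to the right of k are killed by the
    component e - sigma x k; on the others the step function is at most phi k. *)
Lemma step_int_local_le (phi : R -> R) x s (k : R) :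
  {homo phi : u v / u <= v} -> 0 <= phi k ->
  step_wf s -> (forall t, step_fun s t <= phi t) ->
  dot (e - sigma x k) (step_int e x s) <= phi k *: e.
Proof.
move=> phi_mono phik0 wf sphi.
set p := e - sigma x k.
have hp : component e p by apply/componentC/(spectral_component dotP Vdc).
have p0 := component_ge0 hp.
(* all breakpoints of s, and k *)
pose r := sort <=%R (k :: [seq q.1.2 | q <- s] ++ [seq q.2 | q <- s]).
have sr : sorted <=%R r by apply: sort_sorted; exact: le_total.
have kr : k \in r by rewrite mem_sort inE eqxx.
have mono := sorted_leq_nth le_trans (@lexx _ _) 0 sr.
rewrite (step_int_refine e x sr wf); last first.
  move=> q qs; rewrite !mem_sort !inE !mem_cat.
  have h1 := @map_f _ _ (fun q : R * R * R => q.1.2) _ _ qs.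
  have h2 := @map_f _ _ (fun q : R * R * R => q.2) _ _ qs.
  by rewrite h1 h2 !orbT.
have dot_sum (n : nat) (F : nat -> V) :
    dot p (\sum_(0 <= i < n) F i) = \sum_(0 <= i < n) dot p (F i).
  elim: n => [|n IH]; first by rewrite !big_geq // (dot0r dotP).
  by rewrite !big_nat_recr //= (dotDr dotP) IH.
rewrite dot_sum.
apply: (@le_trans _ _ (\sum_(0 <= i < (size r).-1)
    phi k *: dot p (sigma x r`_i - sigma x r`_i.+1))).
  rewrite big_seq_cond [X in _ <= X]big_seq_cond.
  apply: rle_sum => i _; rewrite mem_index_iota andbT /= => ir.
  have {}ir : (i.+1 < size r)%N by rewrite -ltn_predRL.
  have ii : r`_i <= r`_i.+1 by apply: mono; rewrite ?inE// ltnW.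
  rewrite (dotZr dotP).
  have [le|le] := sorted_consecutive sr kr ir.
    apply: rle_scalel; last by apply: le_trans (sphi _) (phi_mono _ _ le).
    apply: (dot_ge0 dotP) => //; apply/rsub_ge0.
    exact: (spectral_decr dotP).
  have h v : k <= v -> dot p (sigma x v) = 0.
    move=> kv; apply: (dot_disj0 dotP).
    have := componentC hp; rewrite /component subKr rmeetC => hs.
    apply: (disj_le _ _ (lexx _) _ hp) => //.
      exact: (spectral_ge0 dotP).
    by rewrite subKr; apply: (spectral_decr dotP).
  have zero : dot p (sigma x r`_i - sigma x r`_i.+1) = 0.
    by rewrite (dotDr dotP) (dotNr dotP) !h ?subrr// (le_trans le).
  by rewrite zero !scaler0.
rewrite -scaler_sumr; apply: rle_scale => //.
rewrite -dot_sum; under eq_bigr do rewrite -opprB.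
rewrite sumrN telescope_sumr // opprB.
set a := sigma x _; set b := sigma x _.
have a1 : a <= e by apply: (spectral_le_unit _ Vdc).
have b0 : 0 <= b by apply: (spectral_ge0 dotP).
have ba : b <= a.
  apply: (spectral_decr dotP) => //; apply: mono => //; rewrite ?inE.
    by rewrite size_sort.
  by rewrite size_sort.
have ab0 : 0 <= a - b by apply/rsub_ge0.
apply: (le_trans (dot_le_unit dotP (component_le hp) ab0)).
by apply: rle_lin (rle_add a1 b0); lmod.
Qed.

(** The step integrals have a supremum in U, although phi may be unbounded:
    they are bounded locally, on each component e - sigma x n. *)
Lemma fun_calc_lub (phi : R -> R) x : laterally_complete V ->
  {homo phi : u v / u <= v} -> (forall t, 0 <= phi t) -> 0 <= x ->
  isLub [set step_int e x s
         | s in [set s | step_wf s /\ forall t, step_fun s t <= phi t]]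
        (fun_calc e phi x).
Proof.
move=> lc phi_mono phi0 x0; apply: (supremum_lub Vdc).
  exists (step_int e x [::]), [::] => //; split=> // t.
  by rewrite /step_fun big_nil.
apply: (@laterally_bounded _ _ _ _ dotP _ (fun n => e - sigma x n%:R)
  (fun n => phi n%:R *: e) lc).
- by move=> n; apply/componentC/(spectral_component dotP Vdc).
- move=> n; cbv beta; set u := sigma x n%:R; set v := sigma x n.+1%:R.
  have : v <= u by apply: (spectral_decr dotP Vdc); rewrite ler_nat.
  by apply: rle_lin; lmod.
- move=> y y0 h; apply: (spectral_full dotP Vdc x0 y0) => n.
  by rewrite rmeetC; apply: (h n.+1).
- by move=> n _ [s [wf sphi] <-]; apply: step_int_local_le.
Qed.

(** The lower Riemann sum of t |-> alpha t - beta for the mesh delta on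
    ]0, n delta]. *)
Definition affine_steps (alpha beta delta : R) (n : nat) : seq (R * R * R) :=
  [seq (alpha * (j%:R * delta) - beta, j%:R * delta, j.+1%:R * delta)
  | j <- iota 0 n].

Lemma affine_steps_wf (alpha beta delta : R) n : 0 <= delta ->
  step_wf (affine_steps alpha beta delta n).
Proof.
move=> d0; apply/allP => q /mapP[j _ ->] /=.
by rewrite ler_wpM2r // ler_nat.
Qed.

Lemma affine_stepsS (alpha beta delta : R) n :
  affine_steps alpha beta delta n.+1 = affine_steps alpha beta delta n ++
  [:: (alpha * (n%:R * delta) - beta, n%:R * delta, n.+1%:R * delta)].
Proof. by rewrite /affine_steps -[X in iota 0 X]addn1 iotaD map_cat. Qed.

Lemma affine_steps_le (phi : R -> R) (alpha beta delta : R) n : 0 <= delta ->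
  0 <= alpha -> (forall t, 0 <= phi t) ->
  (forall t : R, 0 <= t -> alpha * t - beta <= phi t) ->
  forall t, step_fun (affine_steps alpha beta delta n) t <= phi t.
Proof.
move=> d0 a0 phi0 hphi t.
suff : step_fun (affine_steps alpha beta delta n) t <= phi t /\
       (n%:R * delta < t -> step_fun (affine_steps alpha beta delta n) t = 0).
  by case.
elim: n => [|n [IHle IH0]]; first by rewrite /step_fun big_nil.
have n0 : 0 <= n%:R * delta by rewrite mulr_ge0.
have nS : n%:R * delta <= n.+1%:R * delta by rewrite ler_wpM2r // ler_nat.
rewrite affine_stepsS /step_fun big_cat big_seq1 /= -/(step_fun _ t).
have [tn|nt] := leP t (n%:R * delta).
  rewrite mulr0 addr0; split=> // lt.
  by have := lt_le_trans lt (le_trans tn nS); rewrite ltxx.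
rewrite IH0 // add0r; have [tS|St] := leP t (n.+1%:R * delta).
  rewrite mulr1; split=> //; apply: le_trans (hphi _ (le_trans n0 (ltW nt))).
  by rewrite lerD2r ler_wpM2l // ltW.
by rewrite mulr0.
Qed.

(** On sigma_(n delta) - sigma_((n+1) delta), x is at most (n+1) delta, so the
    n-th step falls short of alpha x - beta e by at most alpha delta e. *)
Lemma affine_steps_int_ge (alpha beta delta : R) n x : 0 <= delta -> 0 <= alpha ->
  dot (sigma x 0 - sigma x (n%:R * delta))
      (alpha *: x - (alpha * delta + beta) *: e) <=
  step_int e x (affine_steps alpha beta delta n).
Proof.
move=> d0 a0; elim: n => [|n IH].
  by rewrite mul0r subrr (dot0l dotP) /step_int big_nil.
rewrite affine_stepsS /step_int big_cat big_seq1 /= -/(step_int e x _).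
set u := sigma x (n%:R * delta) in IH *; set v := sigma x (n.+1%:R * delta).
have uv : 0 <= u - v.
  apply/rsub_ge0/(spectral_decr dotP Vdc).
  by rewrite ler_wpM2r // ler_nat.
have uv2 : u - v <= e - v by apply: riesz_lerD2r; apply: spectral_le_unit.
have := spectral_compl_dot_le0 dotP Vdc uv uv2.
move/(rle_scale a0); rewrite scaler0 => h.
have -> : sigma x 0 - v = (sigma x 0 - u) + (u - v) by lmod.
rewrite (dotDl dotP); apply: rle_add IH _.
move: h; rewrite !(dotE dotP) !(dot1r dotP) -[n.+1%:R]natr1.
apply: rle_lin; move: (n%:R : R) => c; lmod.
Qed.

(** Let first the mesh of the lower Riemann sums tend to 0, for a fixed range
    ]0, M]; the remaining defect lives on sigma x M, for every M. *)
Lemma fun_calc_ge_affine (phi : R -> R) (alpha beta : R) x : laterally_complete V ->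
  {homo phi : u v / u <= v} -> (forall t, 0 <= phi t) -> 0 <= x ->
  0 <= alpha -> 0 <= beta ->
  (forall t : R, 0 <= t -> alpha * t - beta <= phi t) ->
  alpha *: x - beta *: e <= fun_calc e phi x.
Proof.
move=> lc phi_mono phi0 x0 a0 b0 hphi.
have [us _] := fun_calc_lub lc phi_mono phi0 x0.
set F := fun_calc e phi x in us *.
have s0x : dot (sigma x 0) x = x.
  have h := spectral_disj e Vdc x 0.
  rewrite scale0r subr0 rpos_id // in h.
  have := dot_disj0 dotP h; rewrite !(dotE dotP) (dot1 dotP) => /eqP.
  by rewrite subr_eq0 => /eqP <-.
(* mesh 1 / (m + 1) on ]0, M] *)
have key (m M : nat) :
    alpha *: x - beta *: e - F - alpha *: dot (sigma x M%:R) x <=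
    m.+1%:R^-1 *: (alpha *: e).
  pose delta : R := m.+1%:R^-1.
  have d0 : 0 <= delta by rewrite /delta invr_ge0.
  have h1 : step_int e x (affine_steps alpha beta delta (M * m.+1)%N) <= F.
    apply: us; exists (affine_steps alpha beta delta (M * m.+1)%N) => //.
    by split; [apply: affine_steps_wf|apply: affine_steps_le].
  have := le_trans (affine_steps_int_ge beta (M * m.+1)%N x d0 a0) h1.
  have -> : (M * m.+1)%N%:R * delta = M%:R.
    by rewrite natrM -mulrA mulfV ?mulr1// pnatr_eq0.
  rewrite -/delta; move: delta d0 {h1} => delta d0.
  set s0 := sigma x 0; set sM := sigma x M%:R => h.
  have s1 : s0 - sM <= e.
    have h1 : s0 <= e by apply: spectral_le_unit.
    have h2 : 0 <= sM by apply: (spectral_ge0 dotP).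
    by apply: rle_lin (rle_add h1 h2); lmod.
  have ab : 0 <= alpha * delta + beta by rewrite addr_ge0 // mulr_ge0.
  move: h; have := rle_scale ab s1; rewrite -/s0 in s0x.
  rewrite !(dotE dotP) !(dot1r dotP) s0x => h1 h2.
  by apply: rle_lin (rle_add h1 h2); lmod.
pose D := alpha *: x - beta *: e - F.
have DM (M : nat) : D <= alpha *: dot (sigma x M%:R) x.
  apply/rsub_ge0; have := archimedean_eps Vdc (fun m => key m M).
  by move/rle_opp; rewrite oppr0 opprB.
suff : rpos D = 0.
  have := rpos_ge D => /[swap] ->; rewrite /D.
  by apply: rle_lin; lmod.
apply: (spectral_full dotP Vdc x0 (rpos_ge0 _)) => n.
set S := sigma x n.+1%:R.
have hS : component e S by apply: (spectral_component dotP Vdc).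
have Sx0 : 0 <= dot S x by apply: (dot_ge0 dotP) => //; apply: component_ge0 hS.
have eS0 : 0 <= e - S by apply: component_ge0 (componentC hS).
have d1 : rmeet (alpha *: dot S x) (e - S) = 0.
  rewrite rmeetC; apply: disjZ => //; rewrite rmeetC (dotC dotP).
  exact: (dot_disj dotP).
apply: (disj_le (rpos_ge0 _) eS0 _ (lexx _) d1).
apply: rpos_le; first exact: DM.
exact: riesz_scaler_ge0.
Qed.

Lemma pos_power_homo (p : R) : 0 <= p ->
  {homo (fun t => Num.max t 0 `^ p) : u v / u <= v}.
Proof.
move=> p0 u v uv; apply: ge0_ler_powR => //.
- by rewrite nnegrE le_max lexx orbT.
- by rewrite nnegrE le_max lexx orbT.
- by rewrite ge_max !le_max uv lexx orbT.
Qed.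

Lemma rpow_ge0 x p : laterally_complete V -> 0 <= p -> 0 <= x ->
  0 <= rpow e x p.
Proof.
move=> lc p0 x0.
have phi0 (t : R) : 0 <= Num.max t 0 `^ p by apply: powR_ge0.
have [us _] := fun_calc_lub lc (pos_power_homo p0) phi0 x0.
apply: us; exists [::]; last by rewrite /step_int big_nil.
by split=> // t; rewrite /step_fun big_nil.
Qed.

(** Each tangent 2tx - t^2 e lies below the right-hand side, because the
    corresponding affine function lies below A s^p + B on the positive reals. *)
Lemma sq_le_rpow x (p A B : R) : laterally_complete V -> 0 <= p -> 0 <= x ->
  0 < A -> 0 <= B -> (forall t, 0 <= t -> t ^+ 2 <= A * t `^ p + B) ->
  dot x x <= A *: rpow e x p + B *: e.
Proof.
move=> lc p0 x0 A0 B0 hAB; have P0 := rpow_ge0 lc p0 x0.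
apply: (sq_lub dotP Vdc) => t; have [t0|/ltW t0] := leP 0 t; last first.
  have h1 := riesz_scaler_ge0 _ _ (ltW A0) P0.
  have h2 := unit_scale_ge0 dotP B0.
  have h3 := unit_scale_ge0 dotP (sqr_ge0 t).
  have t1 : 0 <= - (2 * t) by rewrite oppr_ge0 pmulr_rle0.
  have h4 := riesz_scaler_ge0 _ _ t1 x0.
  by apply: rle_lin (radd_ge0 (radd_ge0 h1 h2) (radd_ge0 h3 h4)); lmod.
have phi0 (u : R) : 0 <= Num.max u 0 `^ p by apply: powR_ge0.
have a0 : 0 <= 2 * t / A by rewrite divr_ge0 ?mulr_ge0// ltW.
have b0 : 0 <= (t ^+ 2 + B) / A by rewrite divr_ge0 ?addr_ge0 ?sqr_ge0// ltW.
have le u : 0 <= u -> 2 * t / A * u - (t ^+ 2 + B) / A <= Num.max u 0 `^ p.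
  move=> u0; rewrite max_l //.
  rewrite mulrAC -mulrBl ler_pdivrMr // mulrC [_ * A]mulrC.
  have := hAB u u0; have := sqr_ge0 (u - t); move: (u `^ p) => z.
  nra.
have := rle_scale (ltW A0)
  (fun_calc_ge_affine lc (pos_power_homo p0) phi0 x0 a0 b0 le).
rewrite -/(rpow e x p) => h.
move: h; rewrite scalerBr !scalerA ![A * (_ / A)]mulrC !divfK ?gt_eqF//.
by apply: rle_lin; lmod.
Qed.

End StepIntegral.


(** * Real powers *)

Section RealInequalities.
Context {R : realType}.
Implicit Types (s p k gamma : R) (a : nat -> R).

(** If s^(p-2) >= a^(gamma-2), the first term on the right is at least s^2;
    otherwise s < a^((gamma-2)/(p-2)) and the second one is. *)
Lemma sq_le_power (a s p gamma : R) : 0 < a -> 0 <= s -> 2 < p ->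
  s ^+ 2 <= a ^+ 2 * (a `^ gamma)^-1 * s `^ p +
            a ^+ 2 * a `^ (2 * (gamma - p) / (p - 2)).
Proof.
move=> a0 s0 p2; pose q := p - 2.
have q0 : 0 < q by rewrite subr_gt0.
have an0 : a != 0 by rewrite gt_eqF.
have B0 (r : R) : 0 <= a ^+ 2 * r `^ (2 * (gamma - p) / (p - 2)).
  by rewrite mulr_ge0 ?powR_ge0// exprn_ge0 // ltW.
have A0 : 0 <= a ^+ 2 * (a `^ gamma)^-1.
  by rewrite mulr_ge0 ?invr_ge0 ?powR_ge0// exprn_ge0 // ltW.
have [->|sn0] := eqVneq s 0.
  by rewrite expr0n /= addr_ge0 // mulr_ge0 // powR_ge0.
have {}s0 : 0 < s by rewrite lt_neqAle eq_sym sn0.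
have sp : s `^ p = s `^ q * s ^+ 2.
  by rewrite -powR_mulrn ?ltW// -powRD ?sn0 ?implybT// /q subrK.
have aA : a ^+ 2 * (a `^ gamma)^-1 = (a `^ (gamma - 2))^-1.
  by rewrite -powR_mulrn ?ltW// -!powRN -powRD ?an0 ?implybT//; congr powR; ring.
have [le|lt] := leP (a `^ (gamma - 2)) (s `^ q).
  rewrite -[leLHS]addr0 lerD // aA sp mulrA.
  rewrite -[leLHS]mul1r ler_wpM2r ?sqr_ge0//.
  by rewrite ler_pdivlMl ?powR_gt0// mulr1.
rewrite -[leLHS]add0r lerD //; first by rewrite mulr_ge0 // powR_ge0.
have -> : a ^+ 2 * a `^ (2 * (gamma - p) / (p - 2)) =
    ((a `^ (gamma - 2)) `^ q^-1) ^+ 2.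
  rewrite -!powR_mulrn ?powR_ge0 ?ltW// -!powRrM -powRD ?an0 ?implybT//.
  by congr powR; rewrite /q; field; rewrite gt_eqF.
have -> : s = (s `^ q) `^ q^-1.
  by rewrite -powRrM mulfV ?gt_eqF// powRr1 // ltW.
rewrite ler_pXn2r ?nnegrE ?powR_ge0//.
apply: ge0_ler_powR; rewrite ?nnegrE ?powR_ge0 ?invr_ge0 ?ltW//.
Qed.

Lemma power_series_bounded a k :
  (forall i, 0 < a i) -> cvgn (series (fun i => (a i `^ k)^-1)) ->
  exists L, forall n, series (fun i => (a i `^ k)^-1) n <= L.
Proof.
move=> a0 cv; exists (limn (series (fun i => (a i `^ k)^-1))).
apply: nondecreasing_cvgn_le => //.
by apply: nondecreasing_series => n _ _; rewrite invr_ge0 powR_ge0.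
Qed.

(** If a were bounded by M, the terms of the series would be bounded below by
    the positive minimum of a_0^(-k) and M^(-k), whatever the sign of k. *)
Lemma summable_powers_unbounded a k :
  (forall i, 0 < a i) -> nondecreasing_seq a ->
  cvgn (series (fun i => (a i `^ k)^-1)) -> forall M, exists n, M <= a n.
Proof.
move=> a0 amono /(power_series_bounded a0)[L hL] M.
apply: contrapT => /forallNP aM.
have {}aM n : a n < M by have /negP := aM n; rewrite -ltNge.
pose m := Num.min (a 0%N `^ (- k)) (M `^ (- k)).
have M0 : 0 < M by apply: lt_trans (a0 0%N) (aM 0%N).
have m0 : 0 < m by rewrite lt_min !powR_gt0.
have ma n : m <= (a n `^ k)^-1.
  rewrite -powRN /m ge_min; apply/orP.
  have [k0|k0] := leP 0 k.
    right; rewrite !powRN lef_pV2 ?posrE ?powR_gt0//.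
    apply: ge0_ler_powR => //; [exact: ltW|exact: ltW|exact: ltW].
  have k1 : 0 <= - k by rewrite oppr_ge0 ltW.
  left; apply: ge0_ler_powR => //; [exact: ltW|exact: ltW|exact: amono].
(* n m exceeds L *)
pose n := (Num.truncn (L / m)).+1.
have : m *+ n <= L.
  apply: le_trans (hL n); rewrite /series /= -[n in m *+ n]subn0 -sumr_const_nat.
  exact: ler_sum.
rewrite -mulr_natl -ler_pdivlMr // leNgt => /negP; apply.
exact: truncnS_gt.
Qed.

(** Since a is nondecreasing and x + k <= 0, a_i^x is at most
    a_0^(x+k) a_i^(-k). *)
Lemma power_series_bounded_le a k x :
  (forall i, 0 < a i) -> nondecreasing_seq a ->
  cvgn (series (fun i => (a i `^ k)^-1)) -> x <= - k ->
  exists c, forall n, series (fun i => a i `^ x) n <= c.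
Proof.
move=> a0 amono /(power_series_bounded a0)[L hL] xk.
pose C := a 0%N `^ (x + k); exists (C * L) => n.
apply: le_trans (ler_wpM2l (powR_ge0 _ _) (hL n)).
rewrite /series /= mulr_sumr; apply: ler_sum => i _.
have -> : a i `^ x = a i `^ (x + k) * (a i `^ k)^-1.
  rewrite -powRN -powRD; first by rewrite addrK.
  by apply/implyP => _; rewrite gt_eqF.
apply: ler_wpM2r; first by rewrite invr_ge0 powR_ge0.
have y0 : 0 <= - (x + k) by rewrite oppr_ge0 -lerBrDr sub0r.
rewrite /C -[x + k]opprK; move: (- (x + k)) y0 => y y0.
rewrite !powRN lef_pV2 ?posrE ?powR_gt0//.
apply: ge0_ler_powR => //; [exact: ltW|exact: ltW|exact: amono].
Qed.

End RealInequalities.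


(** * Conditional expectations on a solid subspace *)

Section Martingales.
Context {R : realType} {V : rieszType R}.
Implicit Types (x y z w b c d : V) (t : R) (F : set V).

Local Ltac lmod := lmod_with R V.

Record solid_subspace F : Prop := SolidSubspace {
  solid_linear : forall (c : R) x y, F x -> F y -> F (c *: x + y) ;
  solid_abs_le : forall x y, F x -> rabs y <= rabs x -> F y
}.

Lemma solid_abs F x : solid_subspace F -> F x -> F (rabs x).
Proof.
move=> FP Fx; apply: (solid_abs_le FP Fx).
by rewrite [rabs (rabs x)]rabs_id // rabs_ge0.
Qed.

Lemma solid_le F x y : solid_subspace F -> F x -> rabs y <= x -> F y.
Proof.
move=> FP Fx yx; apply: (solid_abs_le FP Fx).
exact: le_trans yx (rle_abs x).
Qed.

Variables (e : V) (dot : V -> V -> V).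
Hypothesis dotP : unital_product e dot.
Hypothesis Vdc : dedekind_complete [set: V].
Hypothesis Vlc : laterally_complete V.
Variables (F : set V) (T : nat -> V -> V).
Hypothesis FP : solid_subspace F.
Hypothesis Fe : F e.
Hypothesis TP : filtration F T.
Hypothesis Te : forall i, T i e = e.
Hypothesis T0_pos : forall x, F x -> 0 <= x -> T 0%N x = 0 -> x = 0.

Lemma solid0 : F 0.
Proof. by apply: (solid_le FP Fe); rewrite rabs_id //; apply: (unit_ge0 dotP). Qed.
Lemma solidZ (c : R) x : F x -> F (c *: x).
Proof. by move=> Fx; rewrite -[_ *: x]addr0; apply: (solid_linear FP) => //; apply: solid0. Qed.
Lemma solidD x y : F x -> F y -> F (x + y).
Proof. by move=> Fx Fy; rewrite -[x]scale1r; apply: (solid_linear FP). Qed.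
Lemma solidN x : F x -> F (- x).
Proof. by move=> Fx; rewrite -scaleN1r; apply: solidZ. Qed.
Lemma solidB x y : F x -> F y -> F (x - y).
Proof. by move=> Fx Fy; apply: solidD => //; apply: solidN. Qed.
Lemma solid_ge0_le x y : F x -> 0 <= y -> y <= x -> F y.
Proof. by move=> Fx y0 yx; apply: (solid_le FP Fx); rewrite rabs_id. Qed.
Lemma solid_sum (n : nat) (f : nat -> V) :
  (forall i, F (f i)) -> F (\sum_(0 <= i < n) f i).
Proof.
by move=> Ff; elim/big_ind: _ => //; [apply: solid0|apply: solidD].
Qed.

Lemma condexp_in i x : F x -> F (T i x). Proof. exact: (ce_maps (TP.1 i)). Qed.
Lemma condexpD i x y : F x -> F y -> T i (x + y) = T i x + T i y.
Proof.
by move=> Fx Fy; have := ce_linear (TP.1 i) 1 Fx Fy; rewrite !scale1r.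
Qed.
Lemma condexp0 i : T i 0 = 0.
Proof. by apply: (addrI (T i 0)); rewrite -condexpD ?addr0//; apply: solid0. Qed.
Lemma condexpZ i (c : R) x : F x -> T i (c *: x) = c *: T i x.
Proof.
by move=> Fx; have := ce_linear (TP.1 i) c Fx solid0; rewrite condexp0 !addr0.
Qed.
Lemma condexpN i x : F x -> T i (- x) = - T i x.
Proof. by move=> Fx; rewrite -scaleN1r condexpZ // scaleN1r. Qed.
Lemma condexpB i x y : F x -> F y -> T i (x - y) = T i x - T i y.
Proof. by move=> Fx Fy; rewrite condexpD ?condexpN//; apply: solidN. Qed.
Lemma condexp_ge0 i x : F x -> 0 <= x -> 0 <= T i x.
Proof. exact: (ce_positive (TP.1 i)). Qed.
Lemma condexp_le i x y : F x -> F y -> x <= y -> T i x <= T i y.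
Proof.
move=> Fx Fy /rsub_ge0 xy; apply/rsub_ge0; rewrite -condexpB //.
by apply: condexp_ge0 => //; apply: solidB.
Qed.
Lemma condexp_tower i x : F x -> T 0%N (T i x) = T 0%N x.
Proof.
case: i => [|i] Fx; first exact: (ce_projection (TP.1 0%N)).
by have [] := TP.2 0%N i.+1 isT x Fx.
Qed.

(** Order continuity applied to c - (c /\ x_n), which decreases to 0.  The
    supremum s is taken in V and may lie outside F, whence the detour over c. *)
Lemma condexp_sup_le (x : nat -> V) b c s :
  (forall n, x n <= x n.+1) -> (forall n, F (x n)) -> (forall n, 0 <= x n) ->
  (forall n, T 0%N (x n) <= b) -> isLub (range x) s -> F c -> 0 <= c -> c <= s ->
  T 0%N c <= b.
Proof.
move=> xmono Fx x0 Tx xs Fc c0 cs.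
pose f n := c - rmeet c (x n).
have f0 n : 0 <= f n by apply/rsub_ge0/rmeet_lbl.
have Fm n : F (rmeet c (x n)).
  by apply: (solid_ge0_le Fc); [apply: rmeet_ge0|apply: rmeet_lbl].
have Ff n : F (f n) by apply: solidB.
have fmono m n : (m <= n)%N -> f n <= f m.
  move=> /subnK <-; elim: (n - m)%N => // k IH.
  apply: le_trans IH; rewrite addSn /f.
  have := rmeet_le2 (lexx c) (xmono (k + m)%N).
  by apply: rle_lin; lmod.
have := ce_order_continuous (TP.1 0%N) (D := range f).
case=> [_ [n _ <-]//| | |_ _ glb].
- split=> [|_ _ [m _ <-] [n _ <-]]; first by exists (f 0%N), 0%N.
  exists (f (maxn m n)); split; first by exists (maxn m n).
    by apply: fmono; rewrite leq_maxl.
  by apply: fmono; rewrite leq_maxr.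
- split; [exact: solid0|by move=> _ [n _ <-]|move=> z Fz zf].
  have : rmeet c s <= c - z.
    apply: (rmeet_sup xs) => _ [n _ <-].
    by have := zf (f n) (ex_intro2 _ _ n I erefl); apply: rle_lin; rewrite /f; lmod.
  by rewrite rmeet_l //; apply: rle_lin; lmod.
(* T_0 c - b may be outside F, but its positive part is below an element of F *)
have hz n : rpos (T 0%N c - b) <= T 0%N (f n).
  apply: rpos_le; last exact: condexp_ge0.
  rewrite condexpB //.
  have := condexp_le 0 (Fm n) (Fx n) (rmeet_lbr _ _).
  by move=> h; apply: rle_lin (rle_add h (Tx n)); lmod.
have := glb (rpos (T 0%N c - b)); have := rpos_ge (T 0%N c - b).
move=> h1 h2; apply/rsub_ge0; rewrite -[b - _]opprB -[0]oppr0; apply: rle_opp.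
apply: le_trans h1 _; apply: h2.
  by apply: solid_ge0_le (hz 0%N) => //; [apply: condexp_in|apply: rpos_ge0].
by move=> _ [_ [n _ <-] <-].
Qed.

(** Let c_j be the component where the supremum of the x_n exceeds j.  By Markov
    and order continuity j T_0(c) <= b for c below c_j, so an element below all
    c_j vanishes; and off c_j all x_n are at most j. *)
Lemma condexp_bounded (x : nat -> V) b :
  (forall n, x n <= x n.+1) -> (forall n, F (x n)) -> (forall n, 0 <= x n) ->
  (forall n, T 0%N (x n) <= b) -> has_ubound (range x).
Proof.
move=> xmono Fx x0 Tx.
have ex (j : nat) : exists s, isLub (range (fun n => spectral e (x n) j%:R)) s.
  apply: (lub_exists Vdc); first by exists (spectral e (x 0%N) j%:R), 0%N.
  by exists e => _ [n _ <-]; apply: spectral_le_unit.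
have [c cP] := choice ex.
have hc j : component e (c j).
  apply: component_sup (cP j); first by exists (spectral e (x 0%N) j%:R), 0%N.
  by move=> _ [n _ <-]; apply: (spectral_component dotP Vdc).
have sc j n : spectral e (x n) j%:R <= c j.
  by have [us _] := cP j; apply: us; exists n.
apply: (@laterally_bounded _ _ _ _ dotP _ (fun j => e - c j)
  (fun j => j%:R *: e) Vlc).
- by move=> j; apply: componentC.
- move=> j; cbv beta; suff : c j.+1 <= c j by apply: rle_lin; lmod.
  have [_ ls] := cP j.+1; apply: ls => _ [n _ <-].
  apply: le_trans (sc j n); apply: (spectral_decr dotP Vdc).
  by rewrite ler_nat.
- move=> y y0 yc; apply: (disj_unit dotP); rewrite rmeetC.
  set m := rmeet y e.
  have m0 : 0 <= m by apply: rmeet_ge0 => //; apply: (unit_ge0 dotP).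
  have Fm : F m by apply: (solid_ge0_le Fe) => //; apply: rmeet_lbr.
  apply: T0_pos => //; apply: le_anti; rewrite condexp_ge0 // andbT.
  apply: (archimedean_eps Vdc (y := b)) => j.
  have mc : m <= c j.+1.
    have ec0 : 0 <= e - c j.+1 by apply: component_ge0 (componentC (hc _)).
    have cc0 : 0 <= c j.+1 by apply: component_ge0 (hc _).
    have := rmeetD_le y0 ec0 cc0.
    rewrite subrK [rmeet y (e - _)]rmeetC yc add0r => /le_trans; apply.
    exact: rmeet_lbr.
  have Fs n : F (spectral e (x n) j.+1%:R).
    apply: (solid_ge0_le Fe); first exact: (spectral_ge0 dotP Vdc).
    exact: spectral_le_unit.
  apply: condexp_sup_le (cP j.+1) Fm m0 mc => //.
  + move=> n; apply: (spectral_mono Vdc).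
    exact: riesz_lerD2r.
  + by move=> n; apply: (spectral_ge0 dotP Vdc).
  + move=> n; apply: (@rscale_le _ _ j.+1%:R); first by rewrite ltr0n.
    rewrite scalerA mulfV ?pnatr_eq0// scale1r -condexpZ //.
    apply: le_trans (Tx n); apply: condexp_le => //; first exact: solidZ.
    exact: (spectral_markov dotP Vdc).
- move=> j _ [n _ <-].
  have p0 : 0 <= e - c j by apply: component_ge0 (componentC (hc _)).
  have le : e - c j <= e - spectral e (x n) j%:R.
    by apply: rle_lin (sc j n); lmod.
  have := spectral_compl_dot_le0 dotP Vdc p0 le.
  have := rle_scale (ler0n R j) (component_le (componentC (hc j))).
  rewrite (dotDr dotP (x n)) (dotNr dotP) (dotZr dotP) (dot1r dotP).
  move: (dot _ _) => z h1 h2.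
  by apply: rle_lin (rle_add h1 h2); lmod.
Qed.


Definition sq_int x := F x /\ F (dot x x).

Lemma sq_int_le x y : sq_int x -> rabs y <= x -> sq_int y.
Proof.
move=> [Fx Fxx] yx; split; first exact: (solid_le FP Fx).
apply: (solid_ge0_le Fxx); first exact: (sq_ge0 dotP).
by rewrite -(abs_sq dotP y); apply: (sq_le dotP) => //; apply: rabs_ge0.
Qed.

Lemma sq_intD x y : sq_int x -> sq_int y -> sq_int (x + y).
Proof.
move=> [Fx Fxx] [Fy Fyy]; split; first exact: solidD.
apply: solid_ge0_le (sqD_le dotP x y); last exact: (sq_ge0 dotP).
by apply: solidD; apply: solidZ.
Qed.

Lemma sq_intZ t x : sq_int x -> sq_int (t *: x).
Proof.
move=> [Fx Fxx]; split; first exact: solidZ.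
by rewrite (dotZl dotP) (dotZr dotP); do 2!apply: solidZ.
Qed.

Lemma sq_intB x y : sq_int x -> sq_int y -> sq_int (x - y).
Proof. by move=> hx hy; rewrite -scaleN1r; apply: sq_intD => //; apply: sq_intZ. Qed.

Lemma sq_int_abs x : sq_int x -> sq_int (rabs x).
Proof.
move=> [Fx Fxx]; split; last by rewrite (abs_sq dotP).
exact: (solid_abs FP).
Qed.

Lemma sq_int_dot x y : sq_int x -> sq_int y -> F (dot x y).
Proof.
move=> [Fx Fxx] [Fy Fyy]; apply: (solid_le FP (solidD Fxx Fyy)).
have h1 := dot_amgm dotP 1 x y; have h2 := dot_amgm dotP (- 1) x y.
have h3 := radd_ge0 (sq_ge0 dotP x) (sq_ge0 dotP y).
apply: rabs_le.
  apply: (@rscale_le _ _ 2) => //.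
  by apply: rle_lin (rle_add h1 h3); lmod.
apply: (@rscale_le _ _ 2) => //.
by apply: rle_lin (rle_add h2 h3); lmod.
Qed.

Definition adapted i x := F x /\ T i x = x.

Lemma adapted_range i x : (T i @` F) x -> adapted i x.
Proof.
move=> [z Fz <-]; split; first exact: condexp_in.
exact: (ce_projection (TP.1 i)).
Qed.

Lemma adaptedW i j x : (i <= j)%N -> adapted i x -> adapted j x.
Proof.
rewrite leq_eqVlt => /predU1P[->//|ij] [Fx Tx]; split=> //.
by rewrite -{1}Tx; have [_ ->] := TP.2 i j ij x Fx.
Qed.

Lemma adaptedD i x y : adapted i x -> adapted i y -> adapted i (x + y).
Proof. by move=> [Fx Tx] [Fy Ty]; split; [apply: solidD|rewrite condexpD // Tx Ty]. Qed.

Lemma adapted_join i x y : adapted i x -> adapted i y -> adapted i (rjoin x y).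
Proof.
move=> [Fx Tx] [Fy Ty]; apply: adapted_range.
have [_ _ h _] := ce_range_subspace (TP.1 i).
by apply: h; [exists x|exists y].
Qed.

Lemma adapted_abs i x : adapted i x -> adapted i (rabs x).
Proof.
move=> [Fx Tx]; apply: adapted_join => //.
by split; [apply: solidN|rewrite condexpN // Tx].
Qed.

(** Kadison-Schwarz: T applied to the tangents 2tx - t^2 e of x^2 gives the
    tangents of T(x)^2. *)
Lemma condexp_sq_ge i x : sq_int x -> dot (T i x) (T i x) <= T i (dot x x).
Proof.
move=> [Fx Fxx]; apply: (sq_lub dotP Vdc) => t.
have -> : (2 * t) *: T i x - t ^+ 2 *: e = T i ((2 * t) *: x - t ^+ 2 *: e).
  by rewrite condexpB ?condexpZ ?Te//; apply: solidZ.
apply: condexp_le => //; last exact: (sq_unit_le dotP).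
by apply: solidB; apply: solidZ.
Qed.

(** Kadison-Schwarz makes T_i(x^2) - x^2 nonnegative, and T_0 kills it.  Strict
    positivity thus replaces a proof that the range of T_i is closed under
    squares. *)
Lemma adapted_sq i x : sq_int x -> adapted i x -> T i (dot x x) = dot x x.
Proof.
move=> hx [Fx Tx]; apply/eqP; rewrite -subr_eq0; apply/eqP.
have [_ Fxx] := hx; have FT := condexp_in i Fxx.
apply: T0_pos; first exact: solidB.
  by apply/rsub_ge0; have := condexp_sq_ge i hx; rewrite Tx.
by rewrite condexpB // condexp_tower // subrr.
Qed.

(** Kadison-Schwarz for b + ta is a polynomial inequality in t, whose quadratic
    term vanishes since T(a^2) = a^2; hence so does its linear term. *)
Lemma condexp_pull_out i a b : sq_int a -> adapted i a -> sq_int b ->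
  T i (dot a b) = dot a (T i b).
Proof.
move=> ha ia hb; have [Fa Fab Fbb] := And3 (ha.1) (sq_int_dot ha hb) hb.2.
have := archimedean_lin Vdc (x := 2 *: (dot a (T i b) - T i (dot a b)))
  (y := T i (dot b b) - dot (T i b) (T i b)).
move=> h; have {h}/eqP : 2 *: (dot a (T i b) - T i (dot a b)) = 0.
  apply: h => t; have := condexp_sq_ge i (sq_intD hb (sq_intZ t ha)).
  have [_ Ta] := ia.
  have Taa := adapted_sq ha ia.
  rewrite condexpD ?condexpZ // ?Ta; last by apply: solidZ. 2: exact: hb.1.
  have -> : dot (b + t *: a) (b + t *: a) =
    dot b b + (2 * t) *: dot a b + (t ^+ 2) *: dot a a.
    by rewrite !(dotE dotP) (dotC dotP b a); lmod.
  rewrite condexpD ?condexpD ?condexpZ ?Taa //; try by do ?[apply: solidD|apply: solidZ] => //; exact: ha.2.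
  rewrite !(dotE dotP) (dotC dotP (T i b) a).
  by apply: rle_lin; lmod.
by rewrite scaler_eq0 pnatr_eq0 /= subr_eq0 => /eqP.
Qed.

Lemma condexp_abs_ge i x : F x -> F (rabs x) -> rabs (T i x) <= T i (rabs x).
Proof.
move=> Fx Fax; apply: rabs_le; first by apply: condexp_le => //; apply: rle_abs.
by rewrite -condexpN //; apply: condexp_le => //; [apply: solidN|apply: rleN_abs].
Qed.

Fixpoint running_max (x : nat -> V) n : V :=
  if n is m.+1 then rjoin (running_max x m) (x m.+1) else x 0%N.

(** With M' = M \/ x', the elements M' - M and M' - x' are disjoint, so their
    product is 0; then M'^2 - M^2 <= 2 (M' - M) x' since the difference is
    (M' - M)^2, and summation by parts does the rest. *)
Lemma doob_pathwise (x : nat -> V) n :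
  dot (running_max x n) (running_max x n) <=
  2 *: dot (running_max x n) (x n)
  - 2 *: \sum_(0 <= k < n) dot (running_max x k) (x k.+1 - x k).
Proof.
elim: n => [|n IH].
  rewrite big_geq // /=; have := sq_ge0 dotP (x 0%N).
  by apply: rle_lin; lmod.
rewrite big_nat_recr //=; set m := running_max x n in IH *.
move: (\sum_(0 <= i < n) _) IH => S IH.
set m' := rjoin m (x n.+1); set x' := x n.+1 in m' *.
have d0 : dot (m' - m) (m' - x') = 0.
  apply: (dot_disj0 dotP).
  have := rpos_disj (x' - m).
  have -> : rpos (x' - m) = m' - m.
    by rewrite /rpos -[0](subrr m) rjoinD rjoinC.
  have -> // : rpos (- (x' - m)) = m' - x'.
  by rewrite opprB /rpos -[0](subrr x') rjoinD.
have sq := sq_ge0 dotP (m' - m).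
move: d0 sq IH; rewrite !(dotE dotP) (dotC dotP m m') => d0 sq IH.
have := rle_add sq IH; apply: rle_lin.
have {}d0 : dot m x' = dot m' x' + dot m' m - dot m' m'.
  by apply/eqP; rewrite -subr_eq0 -d0; apply/eqP; lmod.
by rewrite d0; lmod.
Qed.

(** The stochastic integral in [doob_pathwise] has nonnegative expectation by
    the submartingale property, so T_0(M^2) <= 2 T_0(M x); now use
    4 M x <= 4 x^2 + M^2. *)
Lemma doob_maximal (x : nat -> V) (m n : nat) :
  (forall k, 0 <= x k) -> (forall k, sq_int (x k)) ->
  (forall k, adapted (m + k) (x k)) ->
  (forall k, x k <= T (m + k) (x k.+1)) ->
  T 0%N (dot (running_max x n) (running_max x n)) <=
  4 *: T 0%N (dot (x n) (x n)).
Proof.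
move=> x0 hx ax sub.
set M := running_max x.
have MS k : M k.+1 = rjoin (M k) (x k.+1) by [].
have M0 k : 0 <= M k.
  by case: k => [|k] /=; [apply: x0|apply: le_trans (x0 _) (rjoin_ubr _ _)].
have hM k : sq_int (M k).
  elim: k => [|k IH]; first exact: hx.
  rewrite MS; apply: (sq_int_le (sq_intD IH (hx k.+1))); rewrite rabs_id; last first.
    exact: le_trans (M0 k) (rjoin_ubl _ _).
  apply: rjoin_le.
    by apply: rle_lin (x0 k.+1); lmod.
  by apply: rle_lin (M0 k); lmod.
have aM k : adapted (m + k) (M k).
  elim: k => [|k IH]; first exact: ax.
  rewrite MS; apply: adapted_join; last exact: ax.
  by apply: adaptedW IH; rewrite leq_add2l.
have inc k : 0 <= T 0%N (dot (M k) (x k.+1 - x k)).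
  have hd := sq_intB (hx k.+1) (hx k).
  rewrite -(condexp_tower (m + k)); last exact: sq_int_dot.
  rewrite condexp_pull_out //; apply: condexp_ge0.
    rewrite -condexp_pull_out //; apply: condexp_in; exact: sq_int_dot.
  apply: (dot_ge0 dotP) => //; rewrite condexpB; [|exact: (hx _).1|exact: (hx _).1].
  by rewrite (ax k).2; apply/rsub_ge0.
have FS k : F (\sum_(0 <= i < k) dot (M i) (x i.+1 - x i)).
  by apply: solid_sum => i; apply: sq_int_dot => //; apply: sq_intB.
have S0 : 0 <= T 0%N (\sum_(0 <= k < n) dot (M k) (x k.+1 - x k)).
  elim: n => [|k IH]; first by rewrite big_geq // condexp0.
  rewrite big_nat_recr //= condexpD //.
    exact: radd_ge0.
  by apply: sq_int_dot => //; apply: sq_intB.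
have FMx := sq_int_dot (hM n) (hx n).
have h1 : T 0%N (dot (M n) (M n)) <= 2 *: T 0%N (dot (M n) (x n)).
  have := condexp_le 0 (hM n).2 _ (doob_pathwise x n); rewrite -/M.
  rewrite condexpB ?condexpZ //; [|exact: solidZ|exact: solidZ].
  move=> /(_ (solidB (solidZ _ FMx) (solidZ _ (FS n)))) => h.
  have h2 := rle_scale (ler0n R 2) S0; rewrite scaler0 in h2.
  by apply: rle_lin (rle_add h h2); lmod.
have h2 : 4 *: T 0%N (dot (M n) (x n)) <=
    4 *: T 0%N (dot (x n) (x n)) + T 0%N (dot (M n) (M n)).
  have FX := (hx n).2; have FM := (hM n).2.
  have := dot_amgm dotP 2 (x n) (M n); rewrite (dotC dotP (x n) (M n)).
  have -> : 2 * 2 = 4 :> R by lra.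
  have -> : 2 ^+ 2 = 4 :> R by lra.
  move=> /(condexp_le 0 (solidZ 4 FMx) (solidD (solidZ 4 FX) FM)).
  by rewrite condexpD ?condexpZ//; apply: solidZ.
by apply: rle_lin (rle_add (rle_add h1 h1) h2); lmod.
Qed.


(** * Order convergence of square-bounded martingales *)

Section Convergence.
Variable y : nat -> V.
Hypothesis y_sq : forall i, sq_int (y i).
Hypothesis y_adapted : forall i, adapted i (y i).
Hypothesis y_diff : forall i, T i (y i.+1) = 0.
Variable b : V.
Hypothesis y_bound : forall n, \sum_(0 <= i < n) T 0%N (dot (y i) (y i)) <= b.

Let Z n := \sum_(0 <= i < n.+1) y i.
Let Q n := \sum_(0 <= i < n.+1) T 0%N (dot (y i) (y i)).

Lemma partial_sum_sq n : sq_int (Z n).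
Proof.
elim: n => [|n IH]; first by rewrite /Z big_nat1.
by rewrite /Z big_nat_recr //=; apply: sq_intD.
Qed.

Lemma partial_sum_adapted n : adapted n (Z n).
Proof.
elim: n => [|n IH]; first by rewrite /Z big_nat1.
rewrite /Z big_nat_recr //=; apply: adaptedD => //.
exact: adaptedW IH.
Qed.

Lemma increment_step m k : Z (m + k.+1) - Z m = (Z (m + k) - Z m) + y (m + k).+1.
Proof. by rewrite addnS {1}/Z big_nat_recr //= -/(Z _); lmod. Qed.

Lemma increment_adapted m k : adapted (m + k) (Z (m + k) - Z m).
Proof.
apply: adaptedD; first exact: partial_sum_adapted.
apply: (adaptedW (leq_addr k m)).
have [FZm TZm] := partial_sum_adapted m.
by split; [apply: solidN|rewrite condexpN // TZm].
Qed.

Lemma increment_sq m k : sq_int (Z (m + k) - Z m).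
Proof. by apply: sq_intB; apply: partial_sum_sq. Qed.

(** The cross terms vanish: T_(m+k) pulls out the increment up to time m + k and
    kills the next y. *)
Lemma condexp_increment_sq m k :
  T 0%N (dot (Z (m + k) - Z m) (Z (m + k) - Z m)) = Q (m + k) - Q m.
Proof.
elim: k => [|k IH]; first by rewrite addn0 !subrr (dot0l dotP) condexp0.
rewrite increment_step; set s := Z (m + k) - Z m in IH *.
set u := y (m + k).+1.
have hs : sq_int s by apply: increment_sq.
have hu : sq_int u by apply: y_sq.
have Fsu := sq_int_dot hs hu.
have cross : T 0%N (dot s u) = 0.
  rewrite -(condexp_tower (m + k)) // condexp_pull_out //; last exact: increment_adapted.
  by rewrite /u y_diff (dot0r dotP) condexp0.
rewrite (sqD dotP).
have Fss := hs.2; have Fuu := hu.2.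
rewrite !condexpD //; [|exact: solidZ|by apply: solidD => //; apply: solidZ].
rewrite condexpZ // cross IH addnS {3}/Q big_nat_recr //= -/(Q _) -/u.
by lmod.
Qed.

Let M m := running_max (fun k => rabs (Z (m + k) - Z m)).

Lemma condexp_max_increment_sq m n v : isLub (range Q) v ->
  T 0%N (dot (M m n) (M m n)) <= 4 *: (v - Q m).
Proof.
move=> [uv _].
apply: (@le_trans _ _ (4 *: (Q (m + n) - Q m))); last first.
  by apply: rle_scale => //; apply: riesz_lerD2r; apply: uv; exists (m + n)%N.
rewrite -condexp_increment_sq -(abs_sq dotP (Z (m + n) - Z m)).
apply: (@doob_maximal (fun k => rabs (Z (m + k) - Z m)) m n).
- by move=> k; apply: rabs_ge0.
- by move=> k; apply: sq_int_abs; apply: increment_sq.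
- by move=> k; apply: adapted_abs; apply: increment_adapted.
- move=> k; have hk := increment_adapted m k.
  have [FS _] := increment_sq m k.+1.
  have := condexp_abs_ge (m + k) FS (solid_abs FP FS).
  rewrite {1}increment_step condexpD; [|exact: hk.1|exact: (y_sq _).1].
  by rewrite y_diff addr0 hk.2.
Qed.

Lemma running_max_ge0 m n : 0 <= M m n.
Proof.
by case: n => [|n]; [apply: rabs_ge0|apply: le_trans (rabs_ge0 _) (rjoin_ubr _ _)].
Qed.

Lemma running_max_sq m n : sq_int (M m n).
Proof.
elim: n => [|n IH]; first by apply: sq_int_abs; apply: increment_sq.
have hx := sq_int_abs (increment_sq m n.+1).
have -> : M m n.+1 = rjoin (M m n) (rabs (Z (m + n.+1) - Z m)) by [].
apply: (sq_int_le (sq_intD IH hx)).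
have M0 := running_max_ge0 m n; have x0 := rabs_ge0 (Z (m + n.+1) - Z m).
rewrite rabs_id; last exact: le_trans M0 (rjoin_ubl _ _).
apply: rjoin_le; first by apply: rle_lin x0; lmod.
by apply: rle_lin M0; lmod.
Qed.

(** Through the tangent inequality 2tM - t^2 e <= M^2, the maximal inequality
    for squares bounds T_0(M) itself; t is chosen small later. *)
Lemma condexp_max_increment m n v t : 0 < t -> isLub (range Q) v ->
  T 0%N (M m n) <= (2 / t) *: (v - Q m) + (t / 2) *: e.
Proof.
move=> t0 vP; have := condexp_max_increment_sq m n vP.
have [FM FMM] := running_max_sq m n.
have := condexp_le 0 _ FMM (sq_unit_le dotP t (M m n)).
rewrite condexpB ?condexpZ ?Te //; try exact: solidZ.
move=> /(_ (solidB (solidZ _ FM) (solidZ _ Fe))) h1 h2.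
apply: (@rscale_le _ _ (2 * t)); first by rewrite mulr_gt0.
have -> w : (2 * t) *: ((2 / t) *: w + (t / 2) *: e) = 4 *: w + t ^+ 2 *: e.
  rewrite scalerDr !scalerA; congr (_ *: _ + _ *: _); last by field.
  by rewrite mulrACA mulfV ?gt_eqF//; lra.
by apply: rle_lin (le_trans h1 h2); lmod.
Qed.

Lemma max_increment_bounded m : has_ubound (range (M m)).
Proof.
have [||v vP] := @lub_exists _ _ Vdc (range Q).
- by exists (Q 0%N), 0%N.
- by exists b => _ [n _ <-]; apply: y_bound.
apply: (@condexp_bounded _ ((2 / 1) *: (v - Q m) + (1 / 2) *: e)).
- by move=> n; apply: rjoin_ubl.
- by move=> n; have [] := running_max_sq m n.
- exact: running_max_ge0.
- by move=> n; apply: condexp_max_increment.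
Qed.

(** T_0 of a common lower bound c <= e of the G_m is at most
    (2/t) (v - Q_m) + (t/2) e; first Q_m increases to v, then t goes to 0. *)
Lemma max_increment_inf (G : nat -> V) z :
  (forall m, isLub (range (M m)) (G m)) -> (forall m, z <= G m) -> z <= 0.
Proof.
move=> GP zG.
have [||v vP] := @lub_exists _ _ Vdc (range Q).
- by exists (Q 0%N), 0%N.
- by exists b => _ [n _ <-]; apply: y_bound.
(* z may be outside F; its truncation by the unit is in F *)
set c := rmeet e (rpos z).
have e0 := unit_ge0 dotP.
have c0 : 0 <= c by apply: rmeet_ge0 => //; apply: rpos_ge0.
have Fc : F c by apply: (solid_ge0_le Fe) => //; apply: rmeet_lbl.
have cG m : c <= G m.
  apply: le_trans (rmeet_lbr _ _) _; apply: rpos_le => //.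
  have [us _] := GP m; apply: le_trans (us _ (ex_intro2 _ _ 0%N I erefl)).
  exact: running_max_ge0.
have Tc t m : 0 < t -> T 0%N c <= (2 / t) *: (v - Q m) + (t / 2) *: e.
  move=> t0; apply: condexp_sup_le (GP m) Fc c0 (cG m).
  - by move=> n; apply: rjoin_ubl.
  - by move=> n; have [] := running_max_sq m n.
  - exact: running_max_ge0.
  - by move=> n; apply: condexp_max_increment.
have {}Tc t : 0 < t -> T 0%N c <= (t / 2) *: e.
  move=> t0; set d := (t / 2) *: (T 0%N c - (t / 2) *: e).
  suff : v <= v - d.
    move=> h; have d0 : d <= 0 by apply: rle_lin h; lmod.
    have t2 : 0 < t / 2 by rewrite divr_gt0.
    have : T 0%N c - (t / 2) *: e <= 0.
      by apply: (rscale_le t2); rewrite scaler0.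
    by apply: rle_lin; lmod.
  have [_ lv] := vP; apply: lv => _ [m _ <-].
  have t2 : 0 <= t / 2 by rewrite divr_ge0 // ltW.
  have := rle_scale t2 (Tc t m t0).
  have -> w : (t / 2) *: ((2 / t) *: w + (t / 2) *: e) =
      w + (t / 2) *: ((t / 2) *: e).
    have t21 : t / 2 * (2 / t) = 1 by field; rewrite gt_eqF.
    by rewrite scalerDr [_ *: (_ *: w)]scalerA t21 scale1r.
  by rewrite /d scalerBr; apply: rle_lin; lmod.
have Tc0 : T 0%N c <= 0.
  apply: (archimedean_eps Vdc (y := e)) => n.
  have t0 : 0 < 2 * n.+1%:R^-1 :> R by rewrite mulr_gt0 ?invr_gt0 ?ltr0n.
  have := Tc _ t0.
  by have -> : 2 * n.+1%:R^-1 / 2 = n.+1%:R^-1 :> R by rewrite mulrAC mulfV ?mul1r.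
have cz : c = 0.
  by apply: T0_pos => //; apply: le_anti; rewrite Tc0 condexp_ge0.
by have := disj_unit dotP cz => <-; apply: rpos_ge.
Qed.

(** The tails of (Z_n) lie within G_m of Z_m, so they have suprema and infima,
    whose differences are at most 2 G_m and thus decrease to 0. *)
Lemma martingale_order_cvg : exists l, order_cvg Z l.
Proof.
have exG m : exists g, isLub (range (M m)) g.
  apply: (lub_exists Vdc); last exact: max_increment_bounded.
  by exists (M m 0%N), 0%N.
have [G GP] := choice exG.
have ZG m k : rabs (Z (m + k) - Z m) <= G m.
  have [us _] := GP m; apply: le_trans (us _ (ex_intro2 _ _ k I erefl)).
  by case: k => [|k]; [apply: lexx|apply: rjoin_ubr].
have exhi m : exists u, isLub (range (fun k => Z (m + k)%N)) u.
  apply: (lub_exists Vdc); first by exists (Z (m + 0)%N), 0%N.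
  exists (Z m + G m) => _ [k _ <-].
  by apply: rle_lin (le_trans (rle_abs _) (ZG m k)); lmod.
have exlo m : exists l, infimums (range (fun k => Z (m + k)%N)) l.
  apply: (glb_exists Vdc); first by exists (Z (m + 0)%N), 0%N.
  exists (Z m - G m) => _ [k _ <-].
  by apply: rle_lin (le_trans (rleN_abs _) (ZG m k)); lmod.
have [hi hiP] := choice exhi; have [lo loP] := choice exlo.
have hiG m : hi m <= Z m + G m.
  have [_ ls] := hiP m; apply: ls => _ [k _ <-].
  by apply: rle_lin (le_trans (rle_abs _) (ZG m k)); lmod.
have loG m : Z m - G m <= lo m.
  have [_ ls] := loP m; apply: ls => _ [k _ <-].
  by apply: rle_lin (le_trans (rleN_abs _) (ZG m k)); lmod.
have hiZ m k : Z (m + k)%N <= hi m by have [us _] := hiP m; apply: us; exists k.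
have loZ m k : lo m <= Z (m + k)%N by have [us _] := loP m; apply: us; exists k.
have lohi m n : lo m <= hi n.
  by apply: le_trans (loZ m n) _; rewrite addnC.
have hiS m : hi m.+1 <= hi m.
  have [_ ls] := hiP m.+1; apply: ls => _ [k _ <-].
  by rewrite addSnnS.
have loS m : lo m <= lo m.+1.
  have [_ ls] := loP m.+1; apply: ls => _ [k _ <-].
  by rewrite addSnnS.
have [||l [ll gl]] := @glb_exists _ _ Vdc (range hi).
- by exists (hi 0%N), 0%N.
- by exists (lo 0%N) => _ [n _ <-].
have lhi n : l <= hi n by apply: ll; exists n.
have lol n : lo n <= l by apply: gl => _ [k _ <-].
exists l, (fun n => hi n - lo n); split.
- by move=> n; apply: rle_add (hiS n) (rle_opp (loS n)).
- split=> [_ [n _ <-]|z zh]; first by apply/rsub_ge0.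
  suff : 2^-1 *: z <= 0.
    move=> h; apply: (@rscale_le _ _ 2^-1); first by rewrite invr_gt0.
    by rewrite scaler0.
  apply: (max_increment_inf GP) => m.
  apply: (@rscale_le _ _ 2) => //; rewrite scalerA mulfV // scale1r.
  apply: le_trans (zh _ (ex_intro2 _ _ m I erefl)) _.
  by apply: rle_lin (rle_add (hiG m) (loG m)); lmod.
- move=> n; have := hiZ n 0%N; have := loZ n 0%N; rewrite addn0 => h1 h2.
  apply: rabs_le.
    by apply: rle_lin (rle_add h2 (lol n)); lmod.
  by apply: rle_lin (rle_add h1 (lhi n)); lmod.
Qed.

End Convergence.

End Martingales.


(** * The natural domain of a conditional expectation *)

Section NaturalDomainIdeal.
Context {R : realType} {E U : rieszType R}.
Variables (iota : E -> U) (T1 : E -> E).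
Hypothesis Edc : dedekind_complete [set: E].
Hypothesis iotaP : universal_completion iota.
Hypothesis T1P : cond_expectation [set: E] T1.
Implicit Types (x y z : E) (f g u v w : U) (D : set E).

Local Ltac lmod := lmod_with R U.
Local Ltac lmodE := lmod_with R E.

Lemma iotaD x y : iota (x + y) = iota x + iota y.
Proof. by have [_ lin _ _ _] := iotaP; have := lin 1 x y; rewrite !scale1r. Qed.

Lemma iota0 : iota 0 = 0.
Proof. by apply: (addrI (iota 0)); rewrite -iotaD !addr0. Qed.

Lemma iotaN x : iota (- x) = - iota x.
Proof. by apply/eqP; rewrite -addr_eq0 -iotaD addNr iota0. Qed.

Lemma iota_le x y : (iota x <= iota y) = (x <= y).
Proof.
have [_ _ lat inj _] := iotaP; apply/idP/idP => le.
  have <- : rjoin y x = y; last exact: rjoin_ubr.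
  by apply: inj; rewrite (lat y x).1 rjoin_l.
by rewrite -(rjoin_l le) (lat y x).1 rjoin_ubr.
Qed.

Lemma iota_ge0 x : (0 <= iota x) = (0 <= x).
Proof. by rewrite -{1}iota0 iota_le. Qed.

Lemma iota_dense u : 0 <= u -> u <> 0 ->
  exists x, [/\ 0 <= x, x <> 0 & iota x <= u].
Proof.
move=> u0 un0; have [_ _ _ _ dense] := iotaP.
have [|x x0 xu] := dense u.
  by rewrite lt_neqAle u0 andbT eq_sym; apply/eqP.
exists x; split=> //; first exact: ltW.
by move=> x00; rewrite x00 ltxx in x0.
Qed.

(** A Dedekind complete, order dense Riesz subspace is an ideal: u is the
    supremum of the elements of E below it, since a nonzero gap between u and
    that supremum would contain a nonzero element of E. *)
Lemma iota_ideal x u : 0 <= u -> u <= iota x -> exists z, iota z = u.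
Proof.
move=> u0 ux; pose A := [set z : E | 0 <= z /\ iota z <= u].
have [||z [uz lz]] := @lub_exists _ _ Edc A.
- by exists 0; split; rewrite ?iota0.
- by exists x => z [_ zu]; rewrite -iota_le; apply: le_trans zu ux.
have zle : iota z <= u.
  apply: contrapT => nle.
  have [||y [y0 yn0 yd]] := @iota_dense (rpos (iota z - u)).
  - exact: rpos_ge0.
  - move=> d0; apply: nle; have := rpos_ge (iota z - u); rewrite d0.
    by apply: rle_lin; lmod.
  apply: yn0; apply: le_anti; rewrite y0 andbT.
  have : z <= z - y.
    apply: lz => t At; rewrite -iota_le iotaD iotaN.
    have h1 : rpos (iota z - u) <= iota z - iota t.
      apply: rpos_le; first by apply: rle_lin At.2; lmod.
      by apply/rsub_ge0; rewrite iota_le; apply: uz.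
    by apply: rle_lin (le_trans yd h1); lmod.
  by apply: rle_lin; lmodE.
exists z; apply: contrapT => ne.
have [||y [y0 yn0 yd]] := @iota_dense (u - iota z).
- exact/rsub_ge0.
- by move=> /eqP; rewrite subr_eq0 => /eqP /esym.
have z0 : 0 <= z by apply: uz; split; rewrite ?iota0.
apply: yn0; apply: le_anti; rewrite y0 andbT.
have : z + y <= z.
  apply: uz; split; first exact: radd_ge0.
  by rewrite iotaD; apply: rle_lin yd; lmod.
by apply: rle_lin; lmodE.
Qed.

Lemma T1D x y : T1 (x + y) = T1 x + T1 y.
Proof. by have := ce_linear T1P 1 (x := x) (y := y) I I; rewrite !scale1r. Qed.

Lemma T1_le x y : x <= y -> T1 x <= T1 y.
Proof.
move=> /rsub_ge0 xy; have := ce_positive T1P (x := y - x) I xy.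
have -> : T1 y = T1 x + T1 (y - x) by rewrite -T1D; congr T1; lmodE.
by apply: rle_lin; lmodE.
Qed.

Lemma dom_net_iota x : 0 <= x -> dom_net iota T1 [set x] (iota x).
Proof.
move=> x0; split=> [_ ->//| | |].
- by split=> [|_ _ -> ->]; [exists x|exists x; split].
- split=> [_ [_ -> <-]//|v]; by apply; exists x.
- by exists (iota (T1 x)) => _ [_ -> <-].
Qed.

Lemma dom_iota x : 0 <= x -> dom iota T1 (iota x).
Proof.
move=> x0; split; first by rewrite iota_ge0.
by exists [set x]; apply: dom_net_iota.
Qed.

(** Cut the net of f by g: the elements iota x /\ g come from E by [iota_ideal]
    and increase to f /\ g by infinite distributivity. *)
Lemma dom_le f g : dom iota T1 f -> 0 <= g -> g <= f -> dom iota T1 g.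
Proof.
move=> [f0 [D [D0 [[d Dd] dirD] [uD lD] [v vD]]]] g0 gf; split=> //.
pose D' := [set z : E | exists2 x, D x & iota z = rmeet (iota x) g].
have meetE x : D x -> exists z, iota z = rmeet (iota x) g.
  move=> Dx; apply: (@iota_ideal x); last exact: rmeet_lbl.
  by apply: rmeet_ge0 => //; rewrite iota_ge0; apply: D0.
exists D'; split.
- move=> z [x Dx zE]; rewrite -iota_ge0 zE rmeet_ge0 //.
  by rewrite iota_ge0; apply: D0.
- split=> [|z1 z2 [x1 Dx1 z1E] [x2 Dx2 z2E]].
    by have [z zE] := meetE d Dd; exists z, d.
  have [x [Dx x1x x2x]] := dirD _ _ Dx1 Dx2; have [z zE] := meetE x Dx.
  by exists z; split; [exists x| |]; rewrite // -iota_le zE ?z1E ?z2E;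
    apply: rmeet_le2; rewrite ?iota_le.
- split=> [_ [z [x Dx zE] <-]|w hw]; first by rewrite zE; apply: rmeet_lbr.
  rewrite -(rmeet_l gf); apply: (@rmeet_sup _ _ (iota @` D)) => [//|_ [x Dx <-]].
  have [z zE] := meetE x Dx; rewrite rmeetC -zE.
  by apply: hw; exists z => //; exists x.
- exists v => _ [z [x Dx zE] <-].
  apply: le_trans (vD _ (ex_intro2 _ _ x Dx erefl)).
  rewrite /= iota_le; apply: T1_le; rewrite -iota_le zE.
  exact: rmeet_lbl.
Qed.

Lemma domD f g : dom iota T1 f -> dom iota T1 g -> dom iota T1 (f + g).
Proof.
move=> [f0 [D [D0 [[d Dd] dirD] [uD lD] [v vD]]]].
move=> [g0 [C [C0 [[c Cc] dirC] [uC lC] [w wC]]]].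
split; first exact: radd_ge0.
exists [set z | exists x y, [/\ D x, C y & z = x + y]]; split.
- by move=> _ [x [y [Dx Cy ->]]]; apply: radd_ge0; [apply: D0|apply: C0].
- split=> [|_ _ [x [y [Dx Cy ->]]] [x' [y' [Dx' Cy' ->]]]].
    by exists (d + c), d, c.
  have [x'' [Dx'' h1 h2]] := dirD _ _ Dx Dx'.
  have [y'' [Cy'' h3 h4]] := dirC _ _ Cy Cy'.
  by exists (x'' + y''); split; [exists x'', y''| |]; rewrite ?rle_add.
- split=> [_ [_ [x [y [Dx Cy ->]]] <-]|b hb].
    by rewrite iotaD; apply: rle_add; [apply: uD; exists x|apply: uC; exists y].
  suff : f <= b - g by apply: rle_lin; lmod.
  apply: lD => _ [x Dx <-].
  suff : g <= b - iota x by apply: rle_lin; lmod.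
  apply: lC => _ [y Cy <-].
  have : iota (x + y) <= b by apply: hb; exists (x + y) => //; exists x, y.
  by rewrite iotaD; apply: rle_lin; lmod.
- exists (v + w) => _ [_ [x [y [Dx Cy ->]]] <-] /=.
  rewrite T1D iotaD; apply: rle_add.
    by apply: vD; exists x.
  by apply: wC; exists y.
Qed.

Lemma domZ (c : R) f : 0 <= c -> dom iota T1 f -> dom iota T1 (c *: f).
Proof.
move=> c0 hf; have f0 := hf.1.
apply: (@dom_le (f *+ (Num.truncn c).+1)).
- elim: _.+1 => [|n IH]; last by rewrite mulrS; apply: domD.
  by rewrite mulr0n -iota0; apply: dom_iota.
- exact: riesz_scaler_ge0.
- by rewrite -scaler_nat; apply: rle_scalel => //; rewrite ltW // truncnS_gt.
Qed.

Lemma L1_solid : solid_subspace (L1 iota T1).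
Proof.
split=> [c _ _ [f [g [hf hg ->]]] [f' [g' [hf' hg' ->]]]|_ y [f [g [hf hg ->]]] hy].
  have [c0|/ltW c0] := leP 0 c.
    exists (c *: f + f'), (c *: g + g').
    by split; [apply: domD => //; exact: domZ|apply: domD => //; exact: domZ|lmod].
  have c1 : 0 <= - c by rewrite oppr_ge0.
  exists (- c *: g + f'), (- c *: f + g').
  by split; [apply: domD => //; exact: domZ|apply: domD => //; exact: domZ|lmod].
have hfg := domD hf hg.
have yfg : rabs y <= f + g.
  apply: le_trans hy _; apply: rabs_le.
    by apply: rle_lin (radd_ge0 hg.1 hg.1); lmod.
  by apply: rle_lin (radd_ge0 hf.1 hf.1); lmod.
exists (rpos y), (rpos (- y)); split; last exact: rposBneg.
  apply: dom_le hfg (rpos_ge0 _) _.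
  exact: le_trans (rpos_le_abs _) yfg.
apply: dom_le hfg (rpos_ge0 _) _.
by apply: le_trans (rpos_le_abs _) _; rewrite rabsN.
Qed.

Lemma L1_iota x : 0 <= x -> L1 iota T1 (iota x).
Proof.
move=> x0; exists (iota x), (iota 0); split; try exact: dom_iota.
by rewrite iota0 subr0.
Qed.

(** A nonzero f >= 0 dominates some nonzero iota x, on which S is given by T1. *)
Lemma natural_extension_strictly_positive (S : U -> U) :
  strictly_positive_on [set: E] T1 ->
  cond_expectation (L1 iota T1) S -> natural_extension iota T1 S ->
  forall f, L1 iota T1 f -> 0 <= f -> S f = 0 -> f = 0.
Proof.
move=> sp SP SE f Lf f0 Sf; apply: contrapT => fn0.
have [x [x0 xn0 xf]] := iota_dense f0 fn0.
apply: xn0; apply: (sp x I); rewrite rabs_id //.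
have [uS lS] := SE _ _ (dom_net_iota x0).
have T1x0 : 0 <= T1 x by apply: (ce_positive T1P).
apply: le_anti; rewrite T1x0 andbT -iota_le iota0.
apply: le_trans (uS _ (ex_intro2 _ _ x erefl erefl)) _.
have Lx := L1_iota x0; have LP := L1_solid.
have Ld : L1 iota T1 (f - iota x).
  rewrite addrC -[- iota x]scaleN1r; exact: (solid_linear LP).
have Sd : 0 <= S (f - iota x).
  by apply: (ce_positive SP) => //; apply/rsub_ge0.
have := ce_linear SP 1 Ld Lx; rewrite !scale1r subrK Sf => h.
by rewrite h; apply: rle_lin Sd; lmod.
Qed.

End NaturalDomainIdeal.


(** * Kronecker's lemma *)

Section Kronecker.
Context {R : realType} {V : rieszType R}.
Implicit Types (x y z l : V).

Local Ltac lmod := lmod_with R V.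

Lemma order_cvg_nondecreasing_le (s : nat -> V) l :
  (forall n, s n <= s n.+1) -> order_cvg s l -> forall n, s n <= l.
Proof.
move=> smono [h [hdec [_ inf] hs]] n.
have mono m k : s m <= s (k + m)%N.
  by elim: k => // k IH; apply: le_trans IH (smono _).
have hmono m k : h (k + m)%N <= h m.
  by elim: k => // k; apply: le_trans (hdec _).
suff : s n - l <= 0 by apply: rle_lin; lmod.
apply: inf => _ [m _ <-].
apply: (@le_trans _ _ (s (m + n)%N - l)); first exact: riesz_lerD2r.
apply: (le_trans (rle_abs _)); apply: (le_trans (hs _)).
by rewrite addnC.
Qed.

(** Summation by parts writes the sum of the a_i y_i through the deviations
    Z_n - l, bounded by h_n.  Up to h_n, the normalized sum is bounded by the
    average A_n / a_n of |l| + h_0, h_0, ..., h_(n-1) with weights a_0 and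
    a_(i+1) - a_i.  As an average of decreasing terms it decreases, and for
    n >= m it is at most A_m / a_n + h_m. *)
Lemma kronecker (y : nat -> V) (a : nat -> R) l :
  dedekind_complete [set: V] ->
  (forall i, 0 < a i) -> nondecreasing_seq a -> (forall M, exists n, M <= a n) ->
  order_cvg (fun n => \sum_(0 <= i < n.+1) y i) l ->
  order_cvg (fun n => (a n)^-1 *: \sum_(0 <= i < n.+1) a i *: y i) 0.
Proof.
move=> Vdc a0 amono aub [h [hdec [hlb hinf] hZ]].
pose Z n := \sum_(0 <= i < n.+1) y i.
have h0 n : 0 <= h n by apply: hlb; exists n.
have da n : 0 <= a n.+1 - a n by rewrite subr_ge0; apply: amono.
have ainv n : 0 <= (a n)^-1 by rewrite invr_ge0 ltW.
have hmono m n : (m <= n)%N -> h n <= h m.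
  move=> /subnK <-; elim: (n - m)%N => // k.
  exact: le_trans (hdec _).
(* the summand h_0 ensures that a_n h_n <= A_n already for n = 0 *)
pose A n := a 0%N *: (rabs l + h 0%N) +
  \sum_(0 <= i < n) (a i.+1 - a i) *: h i.
have AS n : A n.+1 = A n + (a n.+1 - a n) *: h n.
  by rewrite /A big_nat_recr //= addrA.
have Ah n : a n *: h n <= A n.
  elim: n => [|n IH].
    rewrite /A big_geq // addr0; apply: rle_scale; first exact: ltW.
    by apply: rle_lin (rabs_ge0 l); lmod.
  rewrite AS; apply: (le_trans (rle_scale (ltW (a0 _)) (hdec n))).
  by apply: rle_lin IH; lmod.
have A0 n : 0 <= A n.
  by apply: le_trans (Ah n); apply: riesz_scaler_ge0 => //; apply: ltW.
pose D n := \sum_(0 <= i < n) (a i.+1 - a i) *: (Z i - l).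
have DS n : D n.+1 = D n + (a n.+1 - a n) *: (Z n - l) by rewrite /D big_nat_recr.
have abel n : \sum_(0 <= i < n.+1) a i *: y i =
    a n *: (Z n - l) - D n + a 0%N *: l.
  elim: n => [|n IH]; first by rewrite big_nat1 /D big_geq // /Z big_nat1; lmod.
  have ZS : Z n.+1 = Z n + y n.+1 by rewrite /Z big_nat_recr.
  by rewrite big_nat_recr //= IH DS ZS; lmod.
have bound n : rabs (\sum_(0 <= i < n.+1) a i *: y i) <= a n *: h n + A n.
  rewrite abel /A.
  have h1 : rabs (a n *: (Z n - l)) <= a n *: h n.
    by rewrite rabsZ ?(ltW (a0 n))//; apply: rle_scale (ltW (a0 n)) (hZ n).
  have h2 : rabs (- D n) <= \sum_(0 <= i < n) (a i.+1 - a i) *: h i.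
    rewrite rabsN; elim: n {h1} => [|n IH].
      by rewrite /D !big_geq // rabs_id.
    rewrite DS big_nat_recr //=; apply: (le_trans (rabsD _ _)); apply: rle_add IH _.
    by rewrite rabsZ //; apply: rle_scale (da n) (hZ n).
  have h3 : rabs (a 0%N *: l) <= a 0%N *: (rabs l + h 0%N).
    rewrite rabsZ ?(ltW (a0 0%N))//; apply: rle_scale; first exact: ltW.
    by apply: rle_lin (h0 0%N); lmod.
  apply: le_trans (rabsD _ _) _; apply: le_trans (rle_add (rabsD _ _) (lexx _)) _.
  by apply: rle_lin (rle_add (rle_add h1 h2) h3); lmod.
exists (fun n => h n + (a n)^-1 *: A n); split.
- move=> n; apply: rle_add (hdec n) _.
  apply: (@rscale_le _ _ (a n)) => //; apply: (@rscale_le _ _ (a n.+1)) => //.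
  rewrite !scalerA [_ * (a n.+1)^-1]mulrAC mulfV ?gt_eqF// mul1r mulfK ?gt_eqF//.
  rewrite AS.
  by apply: rle_lin (rle_scale (da n) (Ah n)); rewrite scalerA; lmod.
- split=> [_ [n _ <-]|z zlb].
    by apply: radd_ge0 => //; apply: riesz_scaler_ge0.
  suff : 2^-1 *: z <= 0.
    move=> hz; apply: (@rscale_le _ _ 2^-1); first by rewrite invr_gt0.
    by rewrite scaler0.
  apply: hinf => _ [m _ <-].
  apply: (@rscale_le _ _ 2) => //; rewrite scalerA mulfV // scale1r.
  suff : z - 2 *: h m <= 0 by apply: rle_lin; lmod.
  apply: (archimedean_eps Vdc (y := A m)) => j.
  have [n0 n0P] := aub j.+1%:R; pose n := maxn n0 m.
  have nP : j.+1%:R <= a n by apply: le_trans n0P (amono _ _ _); rewrite leq_maxl.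
  have mn : (m <= n)%N by rewrite leq_maxr.
  have An : A n <= A m + (a n - a m) *: h m.
    move: n mn {nP} => n /subnK <-; elim: (n - m)%N => [|k IH].
      by rewrite add0n subrr scale0r addr0.
    rewrite addSn AS; have hk := hmono m (k + m)%N (leq_addl _ _).
    by apply: rle_lin (rle_add IH (rle_scale (da (k + m)%N) hk)); lmod.
  have zn := zlb _ (ex_intro2 _ _ n I erefl).
  have hn := hmono _ _ mn.
  have iA := rle_scale (ainv n) An.
  have ham : (a n)^-1 *: (A m + (a n - a m) *: h m) <=
      j.+1%:R^-1 *: A m + h m.
    rewrite scalerDr; apply: rle_add.
      by apply: rle_scalel => //; rewrite lef_pV2 ?posrE.
    rewrite scalerA -[X in _ <= X]scale1r; apply: rle_scalel => //.
    rewrite mulrBr mulVf ?gt_eqF// gerBl.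
    by rewrite mulr_ge0 // ltW.
  have := le_trans zn (rle_add hn (le_trans iA ham)).
  by move: (j.+1%:R^-1 *: A m) => w; apply: rle_lin; lmod.
- move=> n; rewrite subr0 rabsZ //.
  have := rle_scale (ainv n) (bound n).
  by rewrite scalerDr scalerA mulVf ?gt_eqF// scale1r.
Qed.

End Kronecker.

(** * The strong law *)

Theorem corollary6p2 (R : realType) (E U : rieszType R)
  (e : E) (iota : E -> U) (mul : U -> U -> U)
  (T1 : E -> E) (T : nat -> U -> U) (Y : nat -> U)
  (p k gamma : R) (a : nat -> R)
  (hE : dedekind_complete [set: E])
  (he : weak_order_unit [set: E] e)
  (hU : universal_completion iota)
  (hmul : f_algebra_with_unit mul (iota e))
  (hT1 : cond_expectation [set: E] T1)
  (hT1pos : strictly_positive_on [set: E] T1)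
  (hT1e : T1 e = e)
  (hTe : forall i, T i (iota e) = iota e)
  (hp : 2 < p)
  (hY : martingale_difference_sequence iota T1 e p Y T)
  (hpk : gamma + (p / 2 - 1) * k <= p)
  (ha0 : forall i, 0 < a i)
  (ha : nondecreasing_seq a)
  (hak : cvgn (series (fun i => (a i `^ k)^-1)))
  (hsum : order_cvg_series
     (fun i => T 0%N ((a i `^ gamma)^-1 *: rpow (iota e) (rabs (Y i)) p))) :
  order_cvg (fun n => (a n)^-1 *: \sum_(0 <= i < n.+1) Y i) 0.
Proof.
have [[Udc Ulc] _ _ _ _] := hU.
have dotP := jordan_unital hmul; set dot := jordan mul in dotP.
have [_ e0 _] := he.
have LP := L1_solid hE hU hT1; set F := L1 iota T1 in LP.
have Fe : F (iota e) := L1_iota T1 hU e0.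
have [TP T0ext YLp Ydiff] := hY; rewrite -/F in TP.
have T0_pos : forall x, F x -> 0 <= x -> T 0%N x = 0 -> x = 0.
  exact: (natural_extension_strictly_positive hE hU hT1 hT1pos (TP.1 0%N)).
have p0 : 0 <= p by lra.
pose P i := rpow (iota e) (rabs (Y i)) p.
have FP i : F (P i) by have [[]] := YLp i.
have P0 i : 0 <= P i by apply: (rpow_ge0 dotP Udc Ulc p0 (rabs_ge0 _)).
pose x := 2 * (gamma - p) / (p - 2).
have YP i : dot (Y i) (Y i) <= (a i ^+ 2 * (a i `^ gamma)^-1) *: P i +
    (a i ^+ 2 * a i `^ x) *: iota e.
  rewrite -(abs_sq dotP); apply: (sq_le_rpow dotP Udc) => //.
  - exact: rabs_ge0.
  - by rewrite mulr_gt0 ?invr_gt0 ?powR_gt0// exprn_gt0.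
  - by rewrite mulr_ge0 ?powR_ge0// sqr_ge0.
  - by move=> t t0; apply: sq_le_power.
have Ysq i : sq_int dot F (Y i).
  split; first by have [[]] := YLp i.
  apply: (solid_ge0_le LP) (YP i); last exact: (sq_ge0 dotP).
  by apply: (solidD LP); apply: (solidZ dotP LP Fe).
pose y i := (a i)^-1 *: Y i.
have ysq i : sq_int dot F (y i) by apply: (sq_intZ dotP LP Fe).
have yP i : dot (y i) (y i) <= (a i `^ gamma)^-1 *: P i + a i `^ x *: iota e.
  rewrite (dotZl dotP) (dotZr dotP) scalerA.
  have an0 : a i != 0 by rewrite gt_eqF.
  have s0 : 0 <= (a i)^-1 * (a i)^-1 by rewrite mulr_ge0 ?invr_ge0 ?ltW.
  apply: (le_trans (rle_scale s0 (YP i))).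
  have -> : (a i)^-1 * (a i)^-1 = (a i ^+ 2)^-1 by rewrite -invfM expr2.
  by rewrite scalerDr !scalerA !mulKf // expf_eq0.
have yad i : adapted F T i (y i).
  have [_ /(adapted_range TP) [FY TY]] := YLp i.
  split; first exact: (solidZ dotP LP Fe).
  by rewrite (condexpZ dotP LP Fe TP) // TY.
have ydiff i : T i (y i.+1) = 0.
  rewrite (condexpZ dotP LP Fe TP) ?Ydiff ?scaler0 //.
  by have [[]] := YLp i.+1.
have [l lP] := hsum.
have [c cP] : exists c, forall n, series (fun i => a i `^ x) n <= c.
  apply: (power_series_bounded_le ha0 ha hak).
  rewrite /x ler_pdivrMr ?subr_gt0//; nra.
have FaP i : F ((a i `^ gamma)^-1 *: P i) by apply: (solidZ dotP LP Fe).
have ybound n : \sum_(0 <= i < n) T 0%N (dot (y i) (y i)) <= l + c *: iota e.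
  apply: (@le_trans _ _ (\sum_(0 <= i < n) T 0%N ((a i `^ gamma)^-1 *: P i) +
                         series (fun i => a i `^ x) n *: iota e)).
    rewrite /series /= scaler_suml -big_split /=; apply: rle_sum => i _ _.
    have Fxe : F (a i `^ x *: iota e) by apply: (solidZ dotP LP Fe).
    have Txe : a i `^ x *: iota e = T 0%N (a i `^ x *: iota e).
      by rewrite (condexpZ dotP LP Fe TP) // hTe.
    rewrite Txe -(condexpD TP _ (FaP i) Fxe).
    exact: (condexp_le dotP LP Fe TP 0%N (ysq i).2 (solidD LP (FaP i) Fxe) (yP i)).
  apply: rle_add.
    apply: (order_cvg_nondecreasing_le _ lP) => m.
    rewrite /series /= big_nat_recr //=.
    rewrite -[X in X <= _]addr0; apply: rle_add (lexx _) _.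
    apply: (condexp_ge0 TP) (FaP m) _; apply: riesz_scaler_ge0 (P0 m).
    by rewrite invr_ge0 powR_ge0.
  by apply: rle_scalel; [apply: (unit_ge0 dotP)|apply: cP].
have [z zP] := martingale_order_cvg dotP Udc Ulc LP Fe TP hTe T0_pos
  ysq yad ydiff ybound.
have := kronecker Udc ha0 ha (summable_powers_unbounded ha0 ha hak) zP.
congr order_cvg; apply: funext => n; congr (_ *: _).
by apply: eq_bigr => i _; rewrite /y scalerA mulfV ?scale1r// gt_eqF.
Qed.
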